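(* Let $M,H$ be $d\times d$ matrices with entries in $\mathbb{Z}\cup\{-\infty\}$, let $F=I\oplus H$ and $V=(M\otimes(I\oplus H))\oplus H$. Suppose that $F$ is irreducible with strongly connected critical graph $\mathcal{G}^c(F)$, and that $V$ is not the matrix with all entries $-\infty$. Let $m,n\ge 1$ be arbitrary private integers and let $A,B$ be the first components of $(M,H)^m$ and $(M,H)^n$, respectively (the messages of Alice and Bob in the key exchange protocol of the context). Then the attack algorithm described in the context, given only $M,H,A,B$, outputs the common secret key $K_a=K_b$.
   Context: $\mathbb{R}_{\max}=\mathbb{R}\cup\{-\infty\}$ with $a\oplus b=\max(a,b)$, $a\otimes b=a+b$; matrix operations: $(A\oplus B)_{ij}=a_{ij}\oplus b_{ij}$, $(A\otimes B)_{ij}=\bigoplus_k a_{ik}\otimes b_{kj}$; $A^{\otimes t}$ is the $t$-th power with respect to $\otimes$, $A^{\otimes 0}=I$ (the tropical identity: $0$ on the diagonal, $-\infty$ off it). For a scalar $a\in\mathbb R$: $a^-=-a$; a scalar times a matrix ($\otimes$) adds the scalar to every entry. For $F\in\mathbb{R}_{\max}^{d\times d}$, $\mathcal{G}(F)$ is the weighted digraph on nodes $\{1,\dots,d\}$ with arcs $(i,j)$ such that $F_{ij}\neq-\infty$, with weight $F_{ij}$. $F$ is irreducible if $\mathcal{G}(F)$ is strongly connected. $\lambda(F)$ is the maximum cycle mean: the maximum over all cycles of $\mathcal{G}(F)$ of (sum of arc weights)/(length), equal to $-\infty$ if there are no cycles. If $\lambda(F)\ne-\infty$, the critical graph $\mathcal{G}^c(F)$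 is the subgraph consisting of all nodes and arcs of the cycles attaining $\lambda(F)$; a critical cycle is a cycle of $\mathcal{G}^c(F)$, and $l(Z)$ denotes the length of $Z$. For $B\in\mathbb{R}_{\max}^{d\times d}$, $B^+=B\oplus B^{\otimes 2}\oplus\dots\oplus B^{\otimes d}$, and if $\lambda(B)\le 0$, $B^*=I\oplus B\oplus\dots\oplus B^{\otimes(d-1)}$. Adjoint product: $A\circ B=A\oplus B\oplus (A\otimes B)$, adjoint powers $A^{\circ 1}=A$, $A^{\circ(k+1)}=A^{\circ k}\circ A$. Semidirect product of pairs: $(M,G)(A,H)=((M\circ H)\oplus A,\ G\circ H)$, powers $(M,H)^1=(M,H)$, $(M,H)^{k+1}=(M,H)^k(M,H)$. Protocol: $M,H$ are public. Alice picks a private integer $m\ge1$, Bob a private integer $n\ge1$. Alice computes $(M,H)^m=(A,H^{\circ m})$ and sends $A$; Bob computes $(M,H)^n=(B,H^{\circ n})$ and sends $B$. Alice computes $K_a=A\oplus B\oplus H^{\circ m}\oplus(B\otimes H^{\circ m})$, Bob computes $K_b=A\oplus B\oplus H^{\circ n}\oplus(A\otimes H^{\circ n})$; $K_a=K_b$ is the first component of $(M,H)^{m+n}$. Discrete logarithm subroutine (input $A,V,F$). Part 0: find $\lambda=\lambda(F)$ and a critical cycle $Z$; with $U_Z=((\lambda^-\otimes F)^{\otimes l(Z)})^+$ define $(C_Z)_{ij}=(U_Z)_{ij}$ if $j\in Z$ and $-\infty$ otherwise; $(R_Z)_{ij}=(U_Z)_{ij}$ if $i\in Z$ and $-\infty$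 otherwise; $(S_Z)_{ij}=\lambda^-\otimes F_{ij}$ if $(i,j)$ is an arc of $Z$ and $-\infty$ otherwise. Part 1: for $t=0,1,\dots,(d-1)^2$ check if $A=V\otimes F^{\otimes t}$, and return $t$ if found. Part 2: for $k=0,\dots,l(Z)-1$ in turn, check whether there is a real $\mu$, the same for all nodes $i$ of $Z$, with $A_{\cdot i}=\mu\otimes V\otimes(C_Z\otimes S_Z^{\otimes k}\otimes R_Z)_{\cdot i}$ (equality of $i$-th columns) for all nodes $i$ of $Z$, and such that $t=\mu/\lambda(F)$ is a natural number; return the first such $t$. Attack algorithm (input $M,H,A,B$). Step 0: compute $\lambda(H)$, $F=I\oplus H$ and $V=(M\otimes(I\oplus H))\oplus H$. Step 1: if $\lambda(H)\le 0$, check if $A=(M\oplus H)\otimes H^*$ or $B=(M\oplus H)\otimes H^*$; if either is true, return $(M\oplus H)\otimes H^*$ as the key. Otherwise, check if $A=M$ or $B=M$, or find $l_1,l_2\in\{0,\dots,d-2\}$ with $A=V\otimes F^{\otimes l_1}$, $B=V\otimes F^{\otimes l_2}$; set $m=1$ if $A=M$ and $m=l_1+2$ otherwise, $n=1$ if $B=M$ and $n=l_2+2$ otherwise; go to Step 3. Step 2: if $\lambda(H)>0$, check if $A=M$ or $B=M$, or find $l_1,l_2$ with $A=V\otimes F^{\otimes l_1}$, $B=V\otimes F^{\otimes l_2}$ using the discrete logarithm subroutine; set $m,n$ as in Step 1; go to Step 3. Step 3: return the key $A\otimes(I\oplus H)^{\otimes n}$ if $m>n$; $B\otimes(I\oplus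 H)^{\otimes m}$ if $n>m$; $(A\otimes(I\oplus H)^{\otimes n})\oplus (H\otimes(I\oplus H)^{\otimes(n-1)})$ if $m=n$. *)

(* Defs.v *)
From HB Require Import structures.
From mathcomp Require Import all_boot all_order all_algebra.

Set Implicit Arguments.
Unset Strict Implicit.
Unset Printing Implicit Defensive.

Import Order.TTheory GRing.Theory Num.Theory.
Local Open Scope ring_scope.

(* The max-plus semiring R_max = R u {-oo}, with None standing for -oo.  It is
   registered as a semiring, so that on Rmax and on matrices over Rmax the
   ring_scope notations have their tropical meaning: the sum is the maximum
   (or entrywise maximum), the product is the addition of R (or the max-plus
   matrix product), 0 is -oo (or the matrix filled with -oo), 1 is the real
   number 0 (or the tropical identity matrix I), A ^+ t is the tropical power,
   and a *: A adds a to every entry of A. *)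
Definition Rmax (R : Type) : Type := option R.

Definition fin (R : Type) (x : R) : Rmax R := Some x.

Section MaxPlusSemiring.
Variable R : realFieldType.

Definition rmax_add (a b : Rmax R) : Rmax R :=
  match a, b with
  | None, _ => b
  | _, None => a
  | Some x, Some y => fin (Num.max x y)
  end.

Definition rmax_mul (a b : Rmax R) : Rmax R :=
  match a, b with
  | Some x, Some y => fin (x + y)
  | _, _ => None
  end.

Fact rmax_addA : associative rmax_add.
Proof. by move=> [x|] [y|] [z|] //=; rewrite maxA. Qed.

Fact rmax_addC : commutative rmax_add.
Proof. by move=> [x|] [y|] //=; rewrite maxC. Qed.

Fact rmax_add0 : left_id None rmax_add.
Proof. by case. Qed.

Fact rmax_mulA : associative rmax_mul.
Proof. by move=> [x|] [y|] [z|] //=; rewrite addrA. Qed.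

Fact rmax_mulC : commutative rmax_mul.
Proof. by move=> [x|] [y|] //=; rewrite addrC. Qed.

Fact rmax_mul1 : left_id (fin 0) rmax_mul.
Proof. by case=> [x|] //=; rewrite add0r. Qed.

Fact rmax_mulDl : left_distributive rmax_mul rmax_add.
Proof. by move=> [x|] [y|] [z|] //=; rewrite addr_maxl. Qed.

Fact rmax_mul0 : left_zero None rmax_mul.
Proof. by []. Qed.

Fact rmax_1neq0 : fin (0 : R) != None.
Proof. by []. Qed.

HB.instance Definition _ := Choice.copy (Rmax R) (option R).
HB.instance Definition _ :=
  GRing.isNmodule.Build (Rmax R) rmax_addA rmax_addC rmax_add0.
HB.instance Definition _ :=
  GRing.Nmodule_isComNzSemiRing.Build (Rmax R) rmax_mulA rmax_mulC rmax_mul1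
    rmax_mulDl rmax_mul0 rmax_1neq0.

(* x <= 0 as extended reals *)
Definition rmax_nonpos (a : Rmax R) : bool :=
  if a is Some x then x <= 0 else true.

(* a lies in Z u {-oo} *)
Definition rmax_integral (a : Rmax R) : Prop :=
  a = 0 \/ exists z : int, a = fin z%:~R.

End MaxPlusSemiring.

Section Cycles.
Variables (d : nat) (e : rel 'I_d).

(* The (elementary) cycles of the digraph e, each as the sequence of its nodes
   in order; next c i is the successor of i along c, and size c is the length
   of c.  A loop (i, i) is the cycle [:: i]. *)
Definition cycles : seq (seq 'I_d) :=
  [seq c <- [seq tval t | k <- iota 1 d, t <- enum {: k.-tuple 'I_d}]
         | ucycleb e c].

Lemma mem_cycles c : (c \in cycles) = (c != [::]) && ucycleb e c.
Proof.
rewrite mem_filter andbC; case c_cyc: (ucycleb e c); last by rewrite !andbF.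
have /andP[_ c_uniq] := c_cyc; rewrite !andbT.
apply/allpairsPdep/idP => [[k [t [+ _ ->]]]|c_neq0].
  by rewrite mem_iota -size_eq0 size_tuple lt0n => /andP[].
exists (size c), (in_tuple c); rewrite mem_enum mem_iota; split=> //.
rewrite lt0n size_eq0 c_neq0 add1n ltnS -[X in (_ <= X)%N](card_ord d).
by rewrite -(card_uniqP c_uniq) max_card.
Qed.

End Cycles.

Section MaxPlusMatrices.
Variables (R : realFieldType) (d : nat).
Implicit Types (A B C F G H M V : 'M[Rmax R]_d) (Z : seq 'I_d).

Definition arc F : rel 'I_d := fun i j => F i j != 0.

Definition irreducible F : Prop := forall i j, connect (arc F) i j.

(* The tropical product of the entries is the sum of the arc weights. *)
Definition cycle_mean F Z : Rmax R :=
  omap (fun w : R => w / (size Z)%:R) (\prod_(i <- Z) F i (next Z i)).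

(* The maximum cycle mean lambda(F): the sum is a maximum, -oo if empty. *)
Definition mcm F : Rmax R := \sum_(Z <- cycles (arc F)) cycle_mean F Z.

(* The cycles of G(F) that attain lambda(F), and the critical graph that they
   span. *)
Definition optimal_cycles F : seq (seq 'I_d) :=
  [seq Z <- cycles (arc F) | cycle_mean F Z == mcm F].

Definition crit_node F : pred 'I_d :=
  fun i => has (fun Z => i \in Z) (optimal_cycles F).

Definition crit_arc F : rel 'I_d :=
  fun i j => has (fun Z => (i \in Z) && (next Z i == j)) (optimal_cycles F).

Definition critical_cycle F Z : Prop := Z \in cycles (crit_arc F).

Definition crit_strongly_connected F : Prop :=
  forall i j, crit_node F i -> crit_node F j -> connect (crit_arc F) i j.

Definition mxplus B : 'M[Rmax R]_d := \sum_(1 <= k < d.+1) B ^+ k.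

(* Meaningful as the Kleene star B^* only if lambda(B) <= 0. *)
Definition mxstar B : 'M[Rmax R]_d := \sum_(0 <= k < d) B ^+ k.

Definition circ A B : 'M[Rmax R]_d := A + B + A *m B.

Definition semidirect (X Y : 'M[Rmax R]_d * 'M[Rmax R]_d) :=
  (circ X.1 Y.2 + Y.1, circ X.2 Y.2).

(* x, op x x, op (op x x) x, ... for k = 1, 2, 3, ...; the value at k = 0 is
   irrelevant. *)
Definition pos_power (T : Type) (op : T -> T -> T) (x : T) (k : nat) : T :=
  iter k.-1 (fun y => op y x) x.

Definition adjoint_power A k : 'M[Rmax R]_d := pos_power circ A k.

Definition message M H k : 'M[Rmax R]_d := (pos_power semidirect (M, H) k).1.

Definition alice_key H m A B : 'M[Rmax R]_d :=
  A + B + adjoint_power H m + B *m adjoint_power H m.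

Definition bob_key H n A B : 'M[Rmax R]_d :=
  A + B + adjoint_power H n + A *m adjoint_power H n.

Section DiscreteLogarithm.
Variables (F : 'M[Rmax R]_d) (lam : R) (Z : seq 'I_d).

Definition U_mx : 'M[Rmax R]_d := mxplus ((fin (- lam) *: F) ^+ size Z).

Definition C_mx : 'M[Rmax R]_d :=
  \matrix_(i, j) if j \in Z then U_mx i j else 0.

Definition R_mx : 'M[Rmax R]_d :=
  \matrix_(i, j) if i \in Z then U_mx i j else 0.

Definition S_mx : 'M[Rmax R]_d :=
  \matrix_(i, j)
    if (i \in Z) && (next Z i == j) then fin (- lam) * F i j else 0.

(* The check of Part 2 succeeds for k, with resulting exponent t. *)
Definition part2_check A V (k t : nat) : Prop :=
  exists mu : R,
    (forall i, i \in Z ->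
       col i A = fin mu *: (V *m col i (C_mx *m S_mx ^+ k *m R_mx)))
    /\ mu / lam = t%:R.

(* Parts 1 and 2 for fixed lam and Z; the last index is the returned value,
   None if the search ends without success. *)
Inductive dlog_search A V : option nat -> Prop :=
  | DlogPart1 t :
      (t <= (d - 1) ^ 2)%N ->
      A = V *m F ^+ t ->
      (forall s, (s < t)%N -> A <> V *m F ^+ s) ->
      dlog_search A V (Some t)
  | DlogPart2 k t :
      (forall s, (s <= (d - 1) ^ 2)%N -> A <> V *m F ^+ s) ->
      (k < size Z)%N ->
      part2_check A V k t ->
      (forall k' t', (k' < k)%N -> ~ part2_check A V k' t') ->
      dlog_search A V (Some t)
  | DlogFail :
      (forall s, (s <= (d - 1) ^ 2)%N -> A <> V *m F ^+ s) ->
      (forall k t, (k < size Z)%N -> ~ part2_check A V k t) ->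
      dlog_search A V None.

End DiscreteLogarithm.

(* The algorithms are nondeterministic (choice of a critical cycle, choice of
   exponents), hence relations between the input and every possible result;
   the result None stands for a failed search. *)
Definition dlog A V F (r : option nat) : Prop :=
  exists (lam : R) Z,
    [/\ mcm F = fin lam, critical_cycle F Z & dlog_search F lam Z A V r].

(* The search in {0, ..., d-2}, which is empty if d = 1. *)
Definition small_dlog A V F (r : option nat) : Prop :=
  if r is Some l then (l < d.-1)%N /\ A = V *m F ^+ l
  else forall l, (l < d.-1)%N -> A <> V *m F ^+ l.

(* The exponent of one party: 1 if its message A is M, and otherwise l + 2 for
   an l returned by the given search. *)
Inductive exponent M A (search : option nat -> Prop) : option nat -> Prop :=
  | ExponentOne : A = M -> exponent M A search (Some 1%N)
  | ExponentFound l :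
      A <> M -> search (Some l) -> exponent M A search (Some l.+2)
  | ExponentFail : A <> M -> search None -> exponent M A search None.

Definition step3 H A B (m n : nat) : 'M[Rmax R]_d :=
  if (n < m)%N then A *m (1 + H) ^+ n
  else if (m < n)%N then B *m (1 + H) ^+ m
  else A *m (1 + H) ^+ n + H *m (1 + H) ^+ (n - 1).

Definition step3_result H A B (rm rn : option nat) : option 'M[Rmax R]_d :=
  if (rm, rn) is (Some m, Some n) then Some (step3 H A B m n) else None.

Definition attack_F H : 'M[Rmax R]_d := 1 + H.

Definition attack_V M H : 'M[Rmax R]_d := M *m (1 + H) + H.

(* attack M H A B r: on the input M, H, A, B some run of the attack algorithm
   ends with the result r. *)
Inductive attack M H A B : option 'M[Rmax R]_d -> Prop :=
  | AttackStar :
      rmax_nonpos (mcm H) ->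
      A = (M + H) *m mxstar H \/ B = (M + H) *m mxstar H ->
      attack M H A B (Some ((M + H) *m mxstar H))
  | AttackStep1 rm rn :
      rmax_nonpos (mcm H) ->
      A <> (M + H) *m mxstar H ->
      B <> (M + H) *m mxstar H ->
      exponent M A (small_dlog A (attack_V M H) (attack_F H)) rm ->
      exponent M B (small_dlog B (attack_V M H) (attack_F H)) rn ->
      attack M H A B (step3_result H A B rm rn)
  | AttackStep2 rm rn :
      ~~ rmax_nonpos (mcm H) ->
      exponent M A (dlog A (attack_V M H) (attack_F H)) rm ->
      exponent M B (dlog B (attack_V M H) (attack_F H)) rn ->
      attack M H A B (step3_result H A B rm rn).

End MaxPlusMatrices.

(* Main.v *)
(** Write F = I (+) H. The k-th message is V (x) F^(k-2) for k >= 2, and the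
    key is determined by the two messages: any exponents reproducing them give
    the same key. If lambda(H) <= 0, then F^n = H^* for n >= d - 1, which settles
    Step 1. If lambda(H) > 0, the point is Part 2 of the discrete logarithm.
    After normalization by lambda and by a potential, all arcs have weight <= 0
    and the arcs of Z have weight 0. A walk ending on Z can be replaced by a
    walk of any length t > (d-1)^2 in the same class modulo l(Z) without losing
    weight, so C S^t R and F^t agree on the columns of Z, and the check succeeds
    for the true exponent. Conversely, the normalized columns of V (x) F^t are
    only rotated along Z when t grows; a successful check says that they
    equal a rotation of themselves up to a scalar, and following the rotation
    l(Z) times forces this scalar to be neutral, i.e., the returned exponent to
    be the true one. *)

Require Import Defs.
From mathcomp Require Import all_boot all_order all_algebra reals.
From mathcomp Require Import boolp zify lra.

Import GRing.Theory.
Local Open Scope ring_scope.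

Set Implicit Arguments.
Unset Strict Implicit.
Unset Printing Implicit Defensive.

Import Order.TTheory Num.Theory.

(* The order of an idempotent addition; on Rmax and its matrices, where the sum
   is a maximum, it is the (entrywise) order of R u {-oo}. *)
Definition dle (T : nmodType) (a b : T) : Prop := a + b = b.
Notation "a <=+ b" := (dle a b) (at level 70, no associativity).

(** * The order of idempotent additions, on semirings and on max-plus matrices *)

Section AdditiveOrder.
Variable T : nmodType.
Implicit Types a b c : T.

Lemma dle0 a : 0 <=+ a.
Proof. exact: add0r. Qed.

Lemma dle_trans b a c : a <=+ b -> b <=+ c -> a <=+ c.
Proof. by rewrite /dle => ab bc; rewrite -bc addrA ab. Qed.

Lemma dle_anti a b : a <=+ b -> b <=+ a -> a = b.
Proof. by rewrite /dle => ab ba; rewrite -[LHS]ba addrC. Qed.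

Lemma dleD a b c : a <=+ c -> b <=+ c -> a + b <=+ c.
Proof. by rewrite /dle => ac bc; rewrite -addrA bc ac. Qed.

Lemma dleDD a b a' b' : a <=+ a' -> b <=+ b' -> a + b <=+ a' + b'.
Proof. by rewrite /dle => aa bb; rewrite addrACA aa bb. Qed.

Lemma dle_sum (I : eqType) (r : seq I) (P : pred I) (f : I -> T) c :
  (forall i, i \in r -> P i -> f i <=+ c) -> \sum_(i <- r | P i) f i <=+ c.
Proof.
move=> fc; rewrite big_seq_cond.
apply: (big_ind (fun x => x <=+ c)); [exact: dle0|by move=> *; apply: dleD|].
by move=> i /andP[]; apply: fc.
Qed.

Hypothesis addTT : forall a, a + a = a.

Lemma dleDr a b : a <=+ a + b.
Proof. by rewrite /dle addrA addTT. Qed.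

Lemma dleDl a b : b <=+ a + b.
Proof. by rewrite addrC; apply: dleDr. Qed.

Lemma dle_bigsum (I : eqType) (r : seq I) (f : I -> T) i :
  i \in r -> f i <=+ \sum_(j <- r) f j.
Proof. by move=> ir; rewrite (big_rem i ir) /=; apply: dleDr. Qed.

End AdditiveOrder.

Section SemiringOrder.
Variable S : pzSemiRingType.
Implicit Types a b c : S.

Lemma dleM a b a' b' : a <=+ a' -> b <=+ b' -> a * b <=+ a' * b'.
Proof.
move=> aa bb; apply: (@dle_trans _ (a' * b)).
  by rewrite /dle -mulrDl aa.
by rewrite /dle -mulrDr bb.
Qed.

Hypothesis addSS : forall a, a + a = a.

Lemma dleX a b n : a <=+ b -> a ^+ n <=+ b ^+ n.
Proof.
move=> ab; elim: n => [|n IHn]; first exact: addSS.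
by rewrite !exprS; apply: dleM.
Qed.

Lemma dle_exp a m n : 1 <=+ a -> (m <= n)%N -> a ^+ m <=+ a ^+ n.
Proof.
move=> a1 /subnK <-; elim: (n - m)%N => [|k IHk]; first exact: addSS.
by rewrite addSn exprS -[a ^+ m]mul1r; apply: dleM.
Qed.

(** Idempotence collapses the binomial coefficients of the expansion to 1. *)
Lemma expr1D a n : (1 + a) ^+ n = \sum_(0 <= k < n.+1) a ^+ k.
Proof.
elim: n => [|n IHn]; first by rewrite big_nat1 !expr0.
rewrite exprS IHn mulrDl mul1r big_distrr /=.
under [X in _ + X]eq_bigr => k _ do rewrite -exprS.
rewrite !big_nat_recl //= -addrA; congr (_ + _).
rewrite -(big_nat_recl n 0%N (fun k => a ^+ k.+1)) //.
by rewrite big_nat_recr //= addrA addSS.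
Qed.

End SemiringOrder.

Section RmaxOrder.
Variable R : realFieldType.
Implicit Types a b c : Rmax R.

Lemma Rmax_addrr a : a + a = a.
Proof. by case: a => [x|] //; rewrite /GRing.add /= maxxx. Qed.

Lemma mx_addrr m n (X : 'M[Rmax R]_(m, n)) : X + X = X.
Proof. by apply/matrixP=> i j; rewrite mxE Rmax_addrr. Qed.

Lemma dle_mxP m n (X Y : 'M[Rmax R]_(m, n)) :
  X <=+ Y <-> forall i j, X i j <=+ Y i j.
Proof.
split=> [XY i j|XY]; first by rewrite /dle -[in RHS]XY mxE.
by apply/matrixP=> i j; rewrite mxE XY.
Qed.

Lemma dle_fin (x y : R) : fin x <=+ fin y <-> x <= y.
Proof.
rewrite /dle {1}/GRing.add /=; split=> [[<-]|xy]; first by rewrite le_max lexx.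
by congr fin; apply/max_idPr.
Qed.

Lemma dle_neq0 a b : a <=+ b -> a != 0 -> b != 0.
Proof. by case: a b => [x|] [y|]. Qed.

Lemma Rmax_addE a b : a + b = a \/ a + b = b.
Proof.
case: a b => [x|] [y|]; [|by left|by right|by left].
rewrite /GRing.add /=; case: (leP x y) => _; [by right|by left].
Qed.

Lemma Rmax_dle_total a b : a <=+ b \/ b <=+ a.
Proof. by rewrite /dle [b + a]addrC; have [->|->] := Rmax_addE a b; auto. Qed.

Lemma Rmax_sum_attained (I : eqType) (r : seq I) (f : I -> Rmax R) :
  \sum_(i <- r) f i != 0 -> exists2 i, i \in r & f i = \sum_(j <- r) f j.
Proof.
elim: r => [|i r IHr]; first by rewrite big_nil eqxx.
rewrite big_cons; have [-> _|->] := Rmax_addE (f i) (\sum_(j <- r) f j).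
  by exists i; rewrite ?mem_head.
by case/IHr=> k kr <-; exists k; rewrite // inE kr orbT.
Qed.

Lemma Rmax_mulf_neq0 a b : (a * b != 0) = (a != 0) && (b != 0).
Proof. by case: a b => [x|] [y|]. Qed.

Lemma prod_dle1 (I : Type) (r : seq I) (f : I -> Rmax R) :
  (forall i, f i <=+ 1) -> \prod_(i <- r) f i <=+ 1.
Proof.
move=> f1; apply: (big_ind (fun x => x <=+ 1)) => //; first exact: Rmax_addrr.
by move=> x y x1 y1; rewrite -[X in _ <=+ X]mulr1; apply: dleM.
Qed.

Lemma finM (x y : R) : fin x * fin y = fin (x + y).
Proof. by []. Qed.

Lemma finX (x : R) n : fin x ^+ n = fin (x *+ n).
Proof.
by elim: n => [|n IHn]; rewrite ?expr0 // exprS IHn finM mulrS.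
Qed.

Lemma mulmx_entry_dle d (X Y : 'M[Rmax R]_d) i k j :
  X i k * Y k j <=+ (X * Y) i j.
Proof.
rewrite mxE; apply: (dle_bigsum Rmax_addrr (fun k => X i k * Y k j)).
exact: mem_index_enum.
Qed.

Lemma pow_entryD_dle d (X : 'M[Rmax R]_d) m n i k j :
  (X ^+ m) i k * (X ^+ n) k j <=+ (X ^+ (m + n)) i j.
Proof. by rewrite exprD; apply: mulmx_entry_dle. Qed.

Lemma mulmx_attained d (X Y : 'M[Rmax R]_d) i j :
  (X * Y) i j != 0 -> exists k, X i k * Y k j = (X * Y) i j.
Proof. by rewrite mxE => /Rmax_sum_attained[k _ <-]; exists k. Qed.

End RmaxOrder.
Arguments mulmx_entry_dle {R d} X Y i k j.
Arguments pow_entryD_dle {R d} X m n i k j.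

(** * Messages and keys *)

Section Protocol.
Variables (R : realFieldType) (d : nat).
Implicit Types M H A B : 'M[Rmax R]_d.

Let mx_addrr' := @mx_addrr R d d.

Lemma adjoint_powerE H k : (0 < k)%N -> 1 + adjoint_power H k = (1 + H) ^+ k.
Proof.
rewrite /adjoint_power /pos_power; case: k => [//|k] _ /=.
elim: k => [|k IHk]; first by rewrite expr1.
rewrite exprSr -IHk iterS /circ mulmxE; move: (iter _ _ _) => X.
by rewrite mulrDl mul1r mulrDr mulr1 -!addrA; congr (_ + _); rewrite addrCA.
Qed.

Lemma message_step M H k : (0 < k)%N ->
  message M H k.+1 = message M H k * (1 + H) + H + M.
Proof.
case: k => [//|k] _; rewrite /message /pos_power iterS /=.
by rewrite {1}/semidirect /circ /= mulmxE mulrDr mulr1 [_ + H + _]addrAC.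
Qed.

(** Each semidirect step multiplies by [1 + H] and adds [H] and [M]. Both lie below [V], hence below
    [V * (1 + H) ^+ k], and are absorbed. *)
Lemma messageE M H k : message M H k.+2 = attack_V M H * (1 + H) ^+ k.
Proof.
have VH : H + M <=+ attack_V M H.
  rewrite /attack_V mulmxE mulrDr mulr1 addrC -addrA; apply: dleDD.
    exact: mx_addrr'.
  exact: dleDl.
elim: k => [|k IHk].
  (* After commuting, the goal [M + V = V] is [M <=+ V] by definition of [dle]. Absorbed summands
     are treated in this way below as well. *)
  rewrite message_step // {1}/message /= expr0 mulr1 -mulmxE addrC.
  exact: dle_trans (dleDl mx_addrr' _ _) VH.
rewrite message_step // IHk -mulrA -exprSr -addrA addrC.
apply: dle_trans VH _; rewrite -{1}[attack_V M H]mulr1.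
by apply: dleM; [exact: mx_addrr' | apply: (dle_exp _ (m := 0)) => //; apply: dleDr].
Qed.


(** For [m = 1] this is the definition of [V]; for larger [m] the last summand is absorbed. The
    point of the formula is that [m] enters the right-hand side only through its message. *)
Lemma message_add M H m n : (0 < m)%N -> (0 < n)%N ->
  message M H (m + n)
    = message M H m * (1 + H) ^+ n + H * (1 + H) ^+ (n - 1).
Proof.
case: m n => [//|m] [//|n] _ _; rewrite subSS subn0 addSn addnS messageE.
case: m => [|m]; first by rewrite /attack_V mulmxE mulrDl -mulrA -exprS.
rewrite messageE -mulrA -exprD; apply/esym; rewrite addrC addnC addSnnS addnC.
apply: dleM; first exact: dleDl.
by apply: dle_exp; [exact: mx_addrr' | exact: dleDr | rewrite leq_addl].
Qed.

Lemma message_mono M H m n : (0 < m)%N -> (m <= n)%N ->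
  message M H m <=+ message M H n.
Proof.
move=> m0 /subnK <-; elim: (n - m)%N => [|k IHk]; first exact: mx_addrr'.
apply: dle_trans IHk _; rewrite addSn message_step ?addn_gt0 ?m0 ?orbT //.
rewrite -addrA mulrDr mulr1 -addrA; exact: dleDr.
Qed.

Lemma adjoint_power_mul H k : (0 < k)%N ->
  adjoint_power H k = H * (1 + H) ^+ (k - 1).
Proof.
case: k => [//|k] _; rewrite subSS subn0 /adjoint_power /pos_power /=.
elim: k => [|k IHk]; first by rewrite mulr1.
rewrite iterS IHk /circ mulmxE addrAC -{1}[H * _]mulr1 -mulrDr.
rewrite -mulrA -exprSr addrC -{1}[H]mulr1.
apply: dleM; first exact: mx_addrr'.
by apply: (dle_exp _ (m := 0)) => //; apply: dleDr.
Qed.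

Lemma alice_keyE M H m n : (0 < m)%N -> (0 < n)%N ->
  alice_key H m (message M H m) (message M H n) = message M H (m + n).
Proof.
move=> m0 n0; rewrite /alice_key mulmxE.
have -> (X Y K : 'M[Rmax R]_d) : X + Y + K + Y * K = X + (Y * (1 + K) + K).
  by rewrite mulrDr mulr1 -!addrA [K + _]addrC.
rewrite adjoint_powerE // adjoint_power_mul // -message_add // [(n + m)%N]addnC.
by apply: message_mono => //; rewrite leq_addr.
Qed.

Lemma alice_bob_key H n A B : alice_key H n A B = bob_key H n B A.
Proof. by rewrite /alice_key /bob_key [A + B]addrC. Qed.

(** If [m] and [n] differ, the larger one is at least 2, so its message is [V] times a power of
    [1 + H] and the [H] summand of [message_add] is absorbed. For [m = n], possibly 1, that summand
    is kept. *)
Lemma step3_message M H m n : (0 < m)%N -> (0 < n)%N ->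
  step3 H (message M H m) (message M H n) m n = message M H (m + n).
Proof.
rewrite /step3 !mulmxE; case: (ltngtP m n) => [mn|nm|->] m0 n0.
- case: n mn n0 => [//|[|n]] mn _; first by lia.
  by rewrite !addnS !messageE -mulrA -exprD addnC.
- case: m nm m0 => [//|[|m]] nm _; first by lia.
  by rewrite !addSn !messageE -mulrA -exprD.
- by rewrite message_add.
Qed.

Lemma message_add_eq M H m n m' n' :
    (0 < m)%N -> (0 < n)%N -> (0 < m')%N -> (0 < n')%N ->
    message M H m' = message M H m -> message M H n' = message M H n ->
  message M H (m' + n') = message M H (m + n).
Proof.
move=> m0 n0 m0' n0' em en; rewrite message_add // em -message_add //.
by rewrite addnC message_add // en -message_add // addnC.
Qed.

End Protocol.

(** * Walks and elementary cycles *)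

Section Walks.
Variables (R : realFieldType) (d : nat).
Implicit Types (X Y : 'M[Rmax R]_d) (x y : 'I_d) (s c p : seq 'I_d).

(** A walk is given by its start and the list of the nodes that follow, so [size s] is its length
    and [last x s] its end. *)
Fixpoint walk_weight X x s : Rmax R :=
  if s is y :: s' then X x y * walk_weight X y s' else 1.

Lemma walk_weight_cat X x s1 s2 :
  walk_weight X x (s1 ++ s2)
    = walk_weight X x s1 * walk_weight X (last x s1) s2.
Proof. by elim: s1 x => [|y s IHs] x /=; rewrite ?mul1r // IHs mulrA. Qed.

Lemma walk_weight_dle_pow X x s :
  walk_weight X x s <=+ (X ^+ size s) x (last x s).
Proof.
elim: s x => [|y s IHs] x /=; first by rewrite expr0 mxE eqxx; apply: Rmax_addrr.
rewrite exprS; apply: dle_trans (mulmx_entry_dle _ _ _ y _).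
by apply: dleM (IHs y); apply: Rmax_addrr.
Qed.

Lemma pow_attained X t x y : (X ^+ t) x y != 0 ->
  exists s, [/\ size s = t, last x s = y & walk_weight X x s = (X ^+ t) x y].
Proof.
elim: t x => [|t IHt] x.
  rewrite expr0 mxE; case: (x =P y) => [<- _|_]; last by rewrite eqxx.
  by exists [::].
rewrite exprS => XXn0; have [k def_XX] := mulmx_attained XXn0.
move: XXn0; rewrite -def_XX Rmax_mulf_neq0 => /andP[_ /IHt[s [sz_s last_s ws]]].
by exists (k :: s); rewrite /= sz_s last_s ws.
Qed.

Lemma pow_dle_walk X t x y (a : Rmax R) :
    (forall s, size s = t -> last x s = y -> walk_weight X x s <=+ a) ->
  (X ^+ t) x y <=+ a.
Proof.
move=> Xa; have [->|/pow_attained[s [ss ls <-]]] := eqVneq ((X ^+ t) x y) 0.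
  exact: dle0.
exact: Xa.
Qed.

Definition cycle_weight X c : Rmax R := \prod_(i <- c) X i (next c i).

Lemma walk_weight_zip X x s :
  walk_weight X x s = \prod_(e <- zip (belast x s) s) X e.1 e.2.
Proof.
elim: s x => [|y s IHs] x /=; first by rewrite big_nil.
by rewrite big_cons IHs.
Qed.

Lemma map_next x p : uniq (x :: p) -> map (next (x :: p)) (x :: p) = rcons p x.
Proof.
move=> Up; apply: (@eq_from_nth _ x); rewrite size_map ?size_rcons // => i i_lt.
rewrite (nth_map x) // next_nth mem_nth // index_uniq // nth_rcons.
by case: ltnP => // p_le; rewrite nth_default //; case: ifP.
Qed.

Lemma closed_walk_weight X x p : uniq (x :: p) ->
  walk_weight X x (rcons p x) = cycle_weight X (x :: p).
Proof.
move=> Up; rewrite walk_weight_zip belast_rcons -(map_next Up).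
rewrite -[X in zip X _](map_id (x :: p)) zip_map big_map.
by rewrite /cycle_weight.
Qed.

(** All duplicate-free sequences are allowed: one that is not a cycle of the digraph has a factor
    [0], that is, weight -oo. *)
Definition cycles_nonpos X : Prop :=
  forall c, uniq c -> c != [::] -> cycle_weight X c <=+ 1.

(** Induction on the walk: once its tail is elementary, a return to [x] closes an elementary cycle,
    and cutting off this cycle loses no weight. *)
Lemma elementary_walk X x s : cycles_nonpos X ->
  exists s', [/\ uniq (x :: s'), last x s' = last x s &
                 walk_weight X x s <=+ walk_weight X x s'].
Proof.
move=> Xnp; elim: s x => [|y s IHs] x.
  by exists [::]; split=> //; apply: Rmax_addrr.
have [s' [Us' ls ws]] := IHs y.
have w_le : walk_weight X x (y :: s) <=+ walk_weight X x (y :: s').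
  by apply: dleM ws; apply: Rmax_addrr.
have [xs|xNs] := boolP (x \in y :: s'); last first.
  by exists (y :: s'); split=> //; rewrite cons_uniq xNs.
have [p1 [p2 def_s]] : exists p1 p2, y :: s' = rcons p1 x ++ p2.
  by case/splitPr: xs => p1 p2; exists p1, p2; rewrite cat_rcons.
rewrite /= -ls -[last y s']/(last x (y :: s')).
move: Us' w_le; rewrite def_s cat_uniq rcons_uniq.
case/and3P=> /andP[xNp1 Up1] /hasPn p2N Up2 w_le.
have xNp2 : x \notin p2 by apply/negP=> /p2N /=; rewrite mem_rcons mem_head.
exists p2; split; [by rewrite /= xNp2|by rewrite last_cat last_rcons|].
apply: dle_trans w_le _; rewrite walk_weight_cat last_rcons -[X in _ <=+ X]mul1r.
apply: dleM; last exact: Rmax_addrr.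
by rewrite closed_walk_weight /= ?xNp1 //; apply: Xnp => //=; rewrite xNp1.
Qed.

Lemma pow_dle_star X t : cycles_nonpos X -> X ^+ t <=+ mxstar X.
Proof.
move=> Xnp; apply/dle_mxP => x y; apply: pow_dle_walk => s _ <-.
have [s' [Us' ls' ws]] := elementary_walk x s Xnp.
rewrite -ls'; apply: dle_trans ws (dle_trans (walk_weight_dle_pow _ _ _) _).
have : size s' \in index_iota 0 d; last first.
  by move/(dle_bigsum (@mx_addrr R d d) (fun k => X ^+ k))/dle_mxP; apply.
rewrite mem_index_iota /= -[X in (_ < X)%N](card_ord d).
by rewrite -[(size s').+1]/(size (x :: s')) -(card_uniqP Us') max_card.
Qed.

End Walks.

(** * Shortening walks that end on a tight cycle *)

Section ZeroSum.
Variables (R : realFieldType) (T : finZmodType) (E : eqType).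
Variables (delta : E -> T) (w : E -> Rmax R).
Hypothesis w_le1 : forall e, w e <=+ 1.
Implicit Types xs ys : seq E.

Let sum_delta xs : T := \sum_(e <- xs) delta e.
Let prod_w xs : Rmax R := \prod_(e <- xs) w e.

Definition shortened xs ys : Prop :=
  [/\ (size ys < size xs)%N, sum_delta ys = sum_delta xs &
      prod_w xs <=+ prod_w ys].

Lemma shortened_middle xs1 xs2 xs3 : xs2 != [::] -> sum_delta xs2 = 0 ->
  shortened (xs1 ++ xs2 ++ xs3) (xs1 ++ xs3).
Proof.
move=> xs2_n0 s2; split.
- by rewrite !size_cat; case: xs2 xs2_n0 {s2} => //= e xs2 _; lia.
- by rewrite /sum_delta !big_cat /= -/(sum_delta xs2) s2 add0r.
- rewrite /prod_w !big_cat /= -[X in _ <=+ _ * X]mul1r.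
  apply: dleM; first exact: Rmax_addrr.
  by apply: dleM; [apply: prod_dle1 | apply: Rmax_addrr].
Qed.

(** Two equal prefix sums enclose a nonempty block of sum 0, which can be removed. *)
Lemma prefix_sums_inj xs : (exists ys, shortened xs ys) \/
  injective (fun u : 'I_(size xs).+1 => sum_delta (take u xs)).
Proof.
set f := fun u : 'I__ => _; have [/injectiveP|] := boolP (injectiveb f).
  by right.
case/injectivePn=> u [v uv]; wlog {uv} uv : u v / (u < v)%N.
  move=> IH; move: (uv); rewrite neq_ltn => /orP[/IH //|vu fuv].
  exact: IH vu (esym fuv).
move=> fuv; left; exists (take u xs ++ drop v xs).
have def_v : take v xs = take u xs ++ drop u (take v xs).
  by rewrite -{1}(cat_take_drop u (take v xs)) take_takel // ltnW.
have def_xs : xs = take u xs ++ drop u (take v xs) ++ drop v xs.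
  by rewrite catA -def_v cat_take_drop.
rewrite {1}def_xs; apply: shortened_middle.
  rewrite -size_eq0 size_drop size_take_min.
  by have := ltn_ord v; move: uv; rewrite ltnS; lia.
move: fuv; rewrite /f [in RHS]def_v /sum_delta big_cat /= -[LHS]addr0.
by move/addrI.
Qed.

Lemma shortened_perm xs xs' ys :
  perm_eq xs xs' -> shortened xs' ys -> shortened xs ys.
Proof.
move=> pxs; rewrite /shortened /sum_delta /prod_w (perm_size pxs).
by rewrite !(perm_big _ pxs).
Qed.

(** Zero-sum blocks are removed, by induction on the length. If the prefix sums are distinct, there
    are at most [#|T| - 1] terms; in the extremal case the prefix sums exhaust [T], which forces all
    terms to be equal. This is the known structure of the longest zero-sum free sequences. *)
Lemma zero_sum_free_reduction xs : exists ys,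
  [/\ sum_delta ys = sum_delta xs, prod_w xs <=+ prod_w ys &
      (size ys <= #|T| - 2)%N \/
      exists g : T, [/\ g != 0, all (fun e => delta e == g) ys
                  & size ys = (#|T| - 1)%N]].
Proof.
have [n] := ubnP (size xs); elim: n xs => // n IHn xs xs_n.
have red ys : shortened xs ys -> exists ys',
  [/\ sum_delta ys' = sum_delta xs, prod_w xs <=+ prod_w ys' &
      (size ys' <= #|T| - 2)%N \/
      exists g : T, [/\ g != 0, all (fun e => delta e == g) ys'
                  & size ys' = (#|T| - 1)%N]].
  case=> sz_ys s_ys p_ys; have [|ys' [s_ys' p_ys' ?]] := IHn ys.
    exact: leq_trans sz_ys xs_n.
  by exists ys'; rewrite -s_ys; split=> //; apply: dle_trans p_ys'.
have [[ys /red //]|inj] := prefix_sums_inj xs.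
have size_xs : ((size xs).+1 <= #|T|)%N.
  by rewrite -[X in (X <= _)%N]card_ord; apply: leq_card inj.
have [xs_le|xs_gt] := leqP (size xs) (#|T| - 2).
  by exists xs; split; [|exact: Rmax_addrr|left].
have {}size_xs : (size xs).+1 = #|T| by move: size_xs xs_gt; clear; lia.
case: xs => [|e xs] in inj size_xs xs_n xs_gt red *; first by [].
have [all_e|/allPn[f fxs]] := boolP (all (fun g => delta g == delta e) (e :: xs)).
  exists (e :: xs); split; [by []|exact: Rmax_addrr|right].
  exists (delta e); split=> //; last by rewrite -size_xs subSS subn0.
  (* A first term 0 would make the prefix sums of lengths 0 and 1 coincide. *)
  apply/eqP=> de0.
  have := inj (ord0 : 'I_(size xs).+2) (lift ord0 ord0 : 'I_(size xs).+2).
  by rewrite /= /sum_delta take0 big_nil big_seq1 de0 => /(_ erefl)/(congr1 val).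
move: fxs; rewrite inE; have [->|fe /= fxs df] := eqVneq f e; first by rewrite eqxx.
have pxs := perm_to_rem fxs; move: (rem f xs) pxs => rest pxs.
have pexs : perm_eq (e :: xs) (e :: f :: rest) by rewrite perm_cons.
have [[ys /(shortened_perm pexs)/red //]|{}inj] := prefix_sums_inj (e :: f :: rest).
have T_le : (#|T| <= #|'I_(size [:: e, f & rest]).+1|)%N.
  by rewrite card_ord -(perm_size pexs) size_xs.
(* With two different terms [e], [f] in front, [delta f] is itself a prefix sum. The empty prefix
   makes [f] a zero-sum block, the prefix [e] contradicts the choice of [f], and a longer one makes
   [e :: take u rest] a zero-sum block. *)
have /codomP[[u u_lt] /= def_df] := inj_card_onto inj T_le (delta f).
have pexs' : perm_eq (e :: xs) (f :: e :: rest).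
  apply: (perm_trans pexs).
  by rewrite -[e :: f :: rest]/([:: e] ++ [:: f] ++ rest) perm_catCA.
rewrite /sum_delta in def_df.
case: u u_lt def_df => [_|[_|u u_lt]] /=.
- move=> /[!big_nil] df0; apply: (red (e :: rest)).
  apply: (shortened_perm pexs').
  apply: (@shortened_middle [::] [:: f] (e :: rest)) => //.
  by rewrite /sum_delta big_seq1.
- by move=> /[!big_seq1] def_df; rewrite def_df eqxx in df.
move=> /[!big_cons] def_df.
apply: (red (f :: drop u rest)); apply: (shortened_perm pexs').
rewrite -{1}(cat_take_drop u rest).
apply: (@shortened_middle [:: f] (e :: take u rest)) => //.
rewrite /sum_delta big_cons; apply: (@addrI _ (delta f)).
by rewrite addr0 addrCA -def_df.
Qed.

End ZeroSum.

(** * Powers of a nonpositive matrix along a cycle of weight 0 *)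

Section TightCycle.
Variables (R : realFieldType) (d : nat) (G : 'M[Rmax R]_d) (Z : seq 'I_d).
Hypothesis G_le1 : forall i j, G i j <=+ 1.
Hypothesis Z_uniq : uniq Z.
Hypothesis Z_tight : forall i, i \in Z -> G i (next Z i) = 1.

Local Notation l := (size Z).
Local Notation nx := (next Z).

Lemma mem_iter_next k i : (iter k nx i \in Z) = (i \in Z).
Proof. by elim: k => //= k IHk; rewrite mem_next. Qed.

Lemma iter_next_inj k : injective (iter k nx).
Proof.
elim: k => [|k IHk] x y //= /(can_inj (prev_next Z_uniq)); exact: IHk.
Qed.

Lemma iter_next_size i : i \in Z -> iter l nx i = i.
Proof.
move=> iZ; rewrite -(order_cycle (cycle_next Z_uniq) Z_uniq iZ).
exact: (iter_order_cycle (cycle_next Z_uniq)).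
Qed.

Lemma iter_next_mod m n i : i \in Z -> m = n %[mod l] ->
  iter m nx i = iter n nx i.
Proof.
move=> iZ; have iter_mod k : iter k nx i = iter (k %% l) nx i.
  rewrite {1}(divn_eq k l) addnC iterD; congr (iter _ _ _).
  by elim: (k %/ l)%N => //= q IHq; rewrite mulSn iterD IHq iter_next_size.
by rewrite iter_mod => ->; rewrite -iter_mod.
Qed.

Lemma tight_pow k i : i \in Z -> 1 <=+ (G ^+ k) i (iter k nx i).
Proof.
elim: k i => [|k IHk] i iZ; first by rewrite expr0 mxE eqxx; apply: Rmax_addrr.
rewrite exprSr; apply: dle_trans (mulmx_entry_dle _ _ _ (iter k nx i) _).
by rewrite /= Z_tight ?mem_iter_next // mulr1; apply: IHk.
Qed.

(** The hypothesis says, without subtraction, that [t - N] steps along [Z] lead from [z] to [i].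
    These steps have weight 0, so a walk to [z] is prolonged to [i] at no cost. *)
Lemma pow_extend N t z i j : z \in Z -> (N <= t)%N ->
  iter t nx z = iter N nx i -> (G ^+ N) j z <=+ (G ^+ t) j i.
Proof.
move=> zZ Nt; rewrite -{1}(subnKC Nt) iterD => /iter_next_inj def_i.
have := pow_entryD_dle G N (t - N) j z i; rewrite subnKC //; apply: dle_trans.
rewrite -[X in X <=+ _]mulr1 -def_i; apply: dleM; first exact: Rmax_addrr.
exact: tight_pow.
Qed.

Lemma walk_weight_le1 x s : walk_weight G x s <=+ 1.
Proof.
elim: s x => [|y s IHs] x /=; first exact: Rmax_addrr.
by rewrite -[X in _ <=+ X]mulr1; apply: dleM.
Qed.

(* A walk meeting the nodes of Z in the class of i is cut there and continued
   along Z; a walk avoiding this for more than l (d - 1) steps repeats a pair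
   (node, time mod l), and the part in between is removed. *)
Lemma walk_reduction_pigeonhole t i s j : i \in Z -> (l * (d - 1) <= t)%N ->
    last j s \in Z -> iter t nx (last j s) = iter (size s) nx i ->
  walk_weight G j s <=+ (G ^+ t) j i.
Proof.
move=> iZ t_ge; have [n] := ubnP (size s); elim: n s => // n IHn s s_n lastZ cls.
have [s_le|s_gt] := leqP (size s) t.
  apply: dle_trans (walk_weight_dle_pow _ _ _) _; exact: pow_extend.
have l_gt0 : (0 < l)%N by case: (Z) iZ.
(* On [Z], advancing by [l.-1 * t] steps undoes [t] steps, since together they make [l * t]. *)
have target k : iter t nx (iter (k + l.-1 * t) nx i) = iter k nx i.
  rewrite -iterD; apply: iter_next_mod => //.
  by rewrite addnCA -{1}[t]mul1n -mulnDl add1n prednK // addnC mulnC modnMDl.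
(* The left summand records node and time modulo [l] along the walk, the right one the node of [Z]
   from which, at that time, [Z] leads to [i] at time [t]. Since [size s > l * (d - 1)], there are
   more than [l * d] arguments and two values collide. *)
pose f (u : 'I_(size s) + 'I_l) : 'I_d * 'I_l := match u with
  | inl u => (last j (take u s), Ordinal (ltn_pmod u l_gt0))
  | inr r => (iter (r + l.-1 * t) nx i, r) end.
have : ~~ injectiveb f.
  apply/injectiveP=> /leq_card; rewrite card_sum card_prod !card_ord.
  have d_gt0 : (0 < d)%N by case: (d) (i) => // -[].
  by nia.
have cut (u v : 'I_(size s)) : (u < v)%N -> f (inl u) = f (inl v) ->
    walk_weight G j s <=+ (G ^+ t) j i.
  case: u v => [u u_lt] [v v_lt] /= uv [last_uv mod_uv].
  have def_v : take u s ++ drop u (take v s) = take v s.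
    by rewrite -[in RHS](cat_take_drop u (take v s)) take_takel // ltnW.
  have def_s : s = take u s ++ drop u (take v s) ++ drop v s.
    by rewrite catA def_v cat_take_drop.
  have last_u : last (last j (take u s)) (drop u (take v s)) = last j (take u s).
    by rewrite -last_cat def_v.
  have sz_s' : size (take u s ++ drop v s) = (size s - (v - u))%N.
    by rewrite size_cat size_drop size_takel; lia.
  apply: (dle_trans (b := walk_weight G j (take u s ++ drop v s))).
    rewrite {1}def_s !walk_weight_cat last_u.
    rewrite -[X in _ <=+ _ * X]mul1r.
    apply: dleM; first exact: Rmax_addrr.
    by apply: dleM; [apply: walk_weight_le1 | apply: Rmax_addrr].
  have last_s' : last j (take u s ++ drop v s) = last j s.
    by rewrite [in RHS]def_s !last_cat last_u.
  apply: IHn; rewrite ?last_s' //; first by rewrite sz_s'; lia.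
  rewrite cls; apply: iter_next_mod => //; rewrite sz_s'.
  apply/eqP; rewrite -(eqn_modDr (v - u)) subnK; last by lia.
  rewrite -[X in _ == X %[mod _]]addn0 eqn_modDl.
  by rewrite -(eqn_modDr u) subnK ?(ltnW uv) // add0n mod_uv.
have hit (u : 'I_(size s)) (r : 'I_l) : f (inl u) = f (inr r) ->
    walk_weight G j s <=+ (G ^+ t) j i.
  case: u => [u u_lt] /= [last_u def_r].
  have sz_u : size (take u s) = u by rewrite size_takel // ltnW.
  apply: (dle_trans (b := walk_weight G j (take u s))).
    rewrite -{1}(cat_take_drop u s) walk_weight_cat -[X in _ <=+ X]mulr1.
    by apply: dleM; [apply: Rmax_addrr | apply: walk_weight_le1].
  apply: IHn; rewrite ?sz_u ?last_u.
  - exact: leq_trans u_lt _.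
  - by rewrite mem_iter_next.
  - by rewrite target; apply: iter_next_mod; rewrite // -def_r modn_mod.
case/injectivePn=> -[u|r] [[v|q]].
- move=> uv; have : (u != v :> nat) by apply: contraNneq uv => /val_inj->.
  by rewrite neq_ltn => /orP[] /cut cut_uv fuv; apply: cut_uv.
- by move=> _; apply: hit.
- by move=> _ /esym; apply: hit.
- by move=> rq /= [_ rq']; rewrite rq' eqxx in rq.
Qed.

(** * The case where the tight cycle passes through all nodes *)

Section Hamiltonian.
Hypothesis Z_all : forall i, i \in Z.

Let size_Z : l = d.
Proof.
by rewrite -(card_uniqP Z_uniq) -[RHS]card_ord; apply: eq_card => i; rewrite Z_all.
Qed.

Let dist x y := findex nx x y.

Let iter_dist x y : iter (dist x y) nx x = y.
Proof.
by apply: iter_findex; rewrite (fconnect_cycle (cycle_next Z_uniq) (Z_all x)).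
Qed.

Let dist_lt x y : (dist x y < d)%N.
Proof.
rewrite -size_Z -(order_cycle (cycle_next Z_uniq) Z_uniq (Z_all x)).
by apply: findex_max; rewrite (fconnect_cycle (cycle_next Z_uniq) (Z_all x)).
Qed.

(* The number of steps along the Hamiltonian cycle Z that the arc e skips. *)
Definition detour (e : 'I_d * 'I_d) : nat := dist (nx e.1) e.2.

Let iter_detour a b : iter (detour (a, b)).+1 nx a = b.
Proof. by rewrite iterSr iter_dist. Qed.

Let w (e : 'I_d * 'I_d) := G e.1 e.2.

Lemma last_walk_detour s j : last j s =
  iter (size s + \sum_(e <- zip (belast j s) s) detour e) nx j.
Proof.
elim: s j => [|y s IHs] j /=; first by rewrite big_nil.
rewrite IHs big_cons; move: (\sum_(e <- _) _)%N => D.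
rewrite -{1}(iter_detour j y) -iterD.
by rewrite -iterS; congr (iter _ _ _); lia.
Qed.

(** Each arc costs at most [d] steps: at most [d - 1] steps of weight 0 along [Z] to its tail, and
    the arc itself. *)
Lemma walk_through_arcs es j : exists2 N, (N <= size es * d)%N &
  \prod_(e <- es) w e <=+ (G ^+ N) j (iter (N + \sum_(e <- es) detour e) nx j).
Proof.
elim: es j => [|[a b] es IHes] j.
  by exists 0; rewrite // !big_nil /= expr0 mxE eqxx; apply: Rmax_addrr.
have [N N_le wN] := IHes b; exists (dist j a + N.+1)%N.
  by rewrite /= mulSn; have := dist_lt j a; lia.
rewrite !big_cons; apply: dle_trans (pow_entryD_dle _ _ _ _ a _).
rewrite -[X in X <=+ _]mul1r; apply: dleM.
  by rewrite -{2}(iter_dist j a); apply: tight_pow.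
rewrite exprS; apply: dle_trans (mulmx_entry_dle _ _ _ b _).
apply: dleM; first exact: Rmax_addrr.
have iter_b n : iter n nx b = iter (n + ((detour (a, b)).+1 + dist j a)) nx j.
  by rewrite !iterD iter_dist iter_detour.
rewrite iter_b in wN; congr (_ <=+ (G ^+ N) b (iter _ _ _)): wN; lia.
Qed.

(** The first use of the arc costs at most [d] steps, every further one at most [d - 1]: the way
    back along [Z] from head to tail would take [d - 1] steps only for an arc of [Z], whose detour
    is 0. *)
Lemma repeat_arc e k j : (0 < k)%N -> (0 < detour e)%N ->
  exists2 N, (N <= d + (k - 1) * (d - 1))%N &
    w e ^+ k <=+ (G ^+ N) j (iter (N + k * detour e) nx j).
Proof.
case: e => a b; set e := (a, b) => k0 de0; pose c := dist b a.
have c_lt : (c.+1 < d)%N.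
  rewrite ltn_neqAle dist_lt andbT; apply: contraTneq de0 => c_d.
  have := iter_next_size (Z_all b); rewrite (etrans size_Z (esym c_d)).
  by rewrite iterS iter_dist /detour /= => ->; rewrite /dist findex0.
have wab_dle n x : G a b * (G ^+ n) b x <=+ (G ^+ n.+1) a x.
  by rewrite exprS; apply: mulmx_entry_dle.
have loop q : w e ^+ q <=+ (G ^+ (q * c.+1)) b b.
  elim: q => [|q IHq].
    by rewrite !expr0 mxE eqxx; apply: Rmax_addrr.
  rewrite exprS mulSn addSnnS.
  apply: dle_trans (pow_entryD_dle _ _ _ _ a _); rewrite -[X in X <=+ _]mul1r.
  apply: dleM; first by rewrite -{1}(iter_dist b a); apply: tight_pow.
  by apply: dle_trans (wab_dle _ _); apply: dleM; first exact: Rmax_addrr.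
have iter_loop q : iter (q * (c.+1 + detour e)) nx b = b.
  have loop1 : iter (c.+1 + detour e) nx b = b.
    by rewrite addSnnS addnC iterD iter_dist iter_detour.
  by elim: q => // q IHq; rewrite mulSnr iterD loop1.
case: k k0 => // q _; exists (dist j a + (q * c.+1).+1)%N.
  rewrite subSS subn0 addnS -addSn leq_add ?dist_lt // leq_mul2l; lia.
apply: dle_trans (pow_entryD_dle _ _ _ _ a _); rewrite -[X in X <=+ _]mul1r.
apply: dleM; first by rewrite -{2}(iter_dist j a); apply: tight_pow.
rewrite exprS; apply: dle_trans (wab_dle _ _).
apply: dleM; first exact: Rmax_addrr.
have -> : (dist j a + (q * c.+1).+1 + q.+1 * detour e
  = q * (c.+1 + detour e) + ((detour e).+1 + dist j a))%N by lia.
by rewrite !iterD iter_dist iter_detour iter_loop.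
Qed.

Lemma val_sum_inZp (E : Type) (r : seq E) (f : E -> nat) p :
  val (\sum_(e <- r) (inZp (f e) : 'I_p.+1)) = ((\sum_(e <- r) f e) %% p.+1)%N.
Proof.
elim: r => [|e r IHr]; first by rewrite !big_nil mod0n.
by rewrite !big_cons /= IHr modnDm.
Qed.

(* Arcs may be taken in any order, joined by pieces of Z, and arcs whose detours
   add up to 0 modulo d may be dropped. At most d - 2 arcs are short enough;
   d - 1 arcs all have the same detour, and repeating the heaviest one gives the
   length (d - 1)^2 + 1. *)
Lemma walk_reduction_hamiltonian t i s j : ((d - 1) ^ 2 < t)%N ->
    last j s = i -> size s = t %[mod l] ->
  walk_weight G j s <=+ (G ^+ t) j i.
Proof.
move=> t_gt <- sz_t; have d_gt0 : (0 < d)%N by case: (d) (j) => // -[].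
(* The group of residues modulo [d], which is also [l] here; the successor form of the bound gives
   the type its group structure. *)
pose del e : 'I_d.-1.+1 := inZp (detour e).
have w_le1 e : w e <=+ 1 by apply: G_le1.
have [ys [sum_ys wys ys_case]] :=
  zero_sum_free_reduction del w_le1 (zip (belast j s) s).
rewrite walk_weight_zip; apply: dle_trans wys _.
have {}sum_ys : \sum_(e <- ys) detour e
    = \sum_(e <- zip (belast j s) s) detour e %[mod l].
  have := congr1 val sum_ys; rewrite /= !val_sum_inZp prednK //.
  by rewrite size_Z.
(* It suffices to use the arcs of [ys] in a walk of at most [t] steps: the detours then put its end
   in the right class, and [pow_extend] fills up the length. *)
suffices [N N_le wN] : exists2 N, (N <= t)%N &
  \prod_(e <- ys) w e <=+ (G ^+ N) j (iter (N + \sum_(e <- ys) detour e) nx j).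
  apply: dle_trans wN (pow_extend j (Z_all _) N_le _).
  rewrite last_walk_detour -!iterD; apply: iter_next_mod => //.
  rewrite addnCA; apply/eqP; rewrite eqn_modDl; apply/eqP.
  by rewrite -modnDm -sz_t sum_ys modnDm.
have small : (size ys <= d - 2)%N -> exists2 N, (N <= t)%N &
  \prod_(e <- ys) w e <=+ (G ^+ N) j (iter (N + \sum_(e <- ys) detour e) nx j).
  move=> ys_le; have [N N_le wN] := walk_through_arcs ys j; exists N => //.
  apply: leq_trans N_le (leq_trans _ (ltnW t_gt)).
  (* The bound needed here is [(d - 2) * d <= (d - 1) ^ 2]. *)
  apply: (leq_trans (n := (d - 2) * d)); first by rewrite leq_mul2r ys_le orbT.
  by clear; case: d => [|[|k]] //; rewrite !subSS !subn0 expnS expn1; lia.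
case: ys_case; rewrite card_ord prednK //.
case=> g [g_n0 /allP all_g size_ys].
have [/eqP|ys_n0] := posnP (size ys).
  by rewrite size_eq0 => /eqP ys0; apply: small; rewrite ys0.
have [e0 e0_ys e0_max] : exists2 e0, e0 \in ys & forall e, e \in ys -> w e <=+ w e0.
  elim: (ys) ys_n0 => // e [_ _|f r /(_ isT)[e0 e0r e0_max] _].
    by exists e => [|f]; rewrite inE // => /eqP->; apply: Rmax_addrr.
  have [ee0|e0e] := Rmax_dle_total (w e) (w e0).
    by exists e0 => [|h]; rewrite inE ?e0r ?orbT // => /predU1P[->//|/e0_max].
  exists e => [|h]; rewrite inE ?eqxx // => /predU1P[->|/e0_max he0].
    exact: Rmax_addrr.
  exact: dle_trans he0 e0e.
have detour_eq e : e \in ys -> detour e = detour e0.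
  move=> ey; have := all_g _ ey; rewrite -(eqP (all_g _ e0_ys)) => /eqP/(congr1 val).
  by rewrite /= prednK // !modn_small // dist_lt.
have de0 : (0 < detour e0)%N.
  rewrite lt0n; apply: contraNneq g_n0 => de0; rewrite -(eqP (all_g _ e0_ys)).
  by apply/eqP/val_inj; rewrite /= de0 mod0n.
have [N N_le wN] := repeat_arc j ys_n0 de0; exists N.
  apply: leq_trans N_le (leq_trans _ t_gt).
  rewrite size_ys; move: d_gt0; clear.
  by case: d => [|[|k]] // _; rewrite !subSS !subn0 expnS expn1; lia.
have -> : (\sum_(e <- ys) detour e = size ys * detour e0)%N.
  rewrite big_seq (eq_bigr (fun _ => detour e0)) // -big_seq.
  by rewrite big_const_seq count_predT iter_addn_0 mulnC.
apply: dle_trans wN; elim: (ys) e0_max => [|e r IHr] e0_max.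
  by rewrite big_nil; apply: Rmax_addrr.
rewrite big_cons exprS; apply: dleM; first by apply: e0_max; rewrite mem_head.
by apply: IHr => f fr; apply: e0_max; rewrite inE fr orbT.
Qed.

End Hamiltonian.
(** For [l < d] the pigeonhole bound [l * (d - 1)] is at most [(d - 1) ^ 2]. For [l = d] it can be
    too large, and the zero-sum argument takes over. *)
Lemma pow_reduction t N i j : i \in Z -> ((d - 1) ^ 2 < t)%N ->
  N = t %[mod l] -> (G ^+ N) j i <=+ (G ^+ t) j i.
Proof.
move=> iZ t_gt Nt; apply: pow_dle_walk => s sz_s last_s.
have l_le : (l <= d)%N.
  by rewrite -(card_uniqP Z_uniq) -[X in (_ <= X)%N](card_ord d) max_card.
have [l_lt|l_ge] := ltnP l d.
  apply: walk_reduction_pigeonhole; rewrite ?last_s //.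
    apply: leq_trans (ltnW t_gt); rewrite expnS expn1 leq_mul2r; lia.
  by apply: iter_next_mod => //; rewrite sz_s.
apply: walk_reduction_hamiltonian => //; last by rewrite sz_s.
move=> k; have /subset_leqif_card[] : Z \subset 'I_d by apply/subsetP.
rewrite (card_uniqP Z_uniq) card_ord eqn_leq l_le l_ge => _ /esym/subsetP.
exact.
Qed.

End TightCycle.

(** * CSR terms and the discrete logarithm *)

Section CSR.
Variables (R : realFieldType) (d : nat) (G : 'M[Rmax R]_d) (Z : seq 'I_d).
Hypothesis G_le1 : forall i j, G i j <=+ 1.
Hypothesis Z_uniq : uniq Z.
Hypothesis Z_tight : forall i, i \in Z -> G i (next Z i) = 1.

Local Notation l := (size Z).
Local Notation nx := (next Z).

Lemma cycles_nonpos_le1 (X : 'M[Rmax R]_d) :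
  (forall i j, X i j <=+ 1) -> cycles_nonpos X.
Proof.
by move=> X_le1 c _ _; apply: prod_dle1.
Qed.

Lemma pow_le1 n i j : (G ^+ n) i j <=+ 1.
Proof. by apply: pow_dle_walk => s _ _; apply: walk_weight_le1. Qed.

Lemma pow_dle_plus (X : 'M[Rmax R]_d) a : cycles_nonpos X -> (0 < a)%N ->
  X ^+ a <=+ mxplus X.
Proof.
case: a => // a Xnp _; rewrite exprS.
apply: (dle_trans (b := X * mxstar X)).
  by apply: dleM; [exact: mx_addrr | exact: pow_dle_star].
rewrite /mxstar /mxplus mulr_sumr big_add1 /=.
under eq_bigr => k _ do rewrite -exprS; exact: mx_addrr.
Qed.

(** Beyond [(d - 1) ^ 2], a column of a power at a node of [Z] depends only on the position of the
    node minus the exponent, modulo [l]. A walk is prolonged along [Z] to a length congruent to the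
    other exponent and then reduced to that exponent. *)
Lemma tight_pow_eq t t' i i' j : i \in Z -> i' \in Z ->
    ((d - 1) ^ 2 < t)%N -> ((d - 1) ^ 2 < t')%N ->
    iter t' nx i = iter t nx i' ->
  (G ^+ t) j i = (G ^+ t') j i'.
Proof.
suff le u u' k k' : k \in Z -> k' \in Z -> ((d - 1) ^ 2 < u')%N ->
    iter u' nx k = iter u nx k' -> (G ^+ u) j k <=+ (G ^+ u') j k'.
  by move=> iZ i'Z t_gt t'_gt eqi; apply: dle_anti; apply: le.
move=> kZ k'Z u'_gt eqk; have l_gt0 : (0 < l)%N by case: (Z) kZ.
(* The length [u * l + u'] is at least [u], as [pow_extend] requires, and congruent to [u']. *)
have mod_u' : (u * l + u' = u' %[mod l])%N by rewrite modnMDl.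
apply: dle_trans (pow_reduction G_le1 Z_uniq Z_tight j k'Z u'_gt mod_u').
apply: (pow_extend Z_uniq Z_tight _ kZ); last first.
  by rewrite (iter_next_mod Z_uniq kZ mod_u').
by rewrite (leq_trans _ (leq_addr _ _)) // leq_pmulr.
Qed.

Lemma S_mx_pow k i j : i \in Z ->
  (S_mx G 0 Z ^+ k) i j = (iter k nx i == j)%:R.
Proof.
elim: k i => [|k IHk] i iZ; first by rewrite expr0 mxE mulrb.
rewrite exprS mxE (bigD1 (nx i)) //= big1 ?addr0; last first.
  move=> x nix; rewrite mxE iZ /= eq_sym (negPf nix).
  by rewrite mul0r.
rewrite mxE iZ eqxx /= oppr0 Z_tight // !mul1r IHk ?mem_next //.
by rewrite -iterSr.
Qed.

(** Upper bound: the product expands into powers of [G] with exponents congruent to [k], each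
    reduced to [t]. Lower bound: a single term of the product, through the node [x] that lies [k]
    steps before [i] on [Z], already reaches the entry of [G ^+ t]. *)
Lemma CSR_tight t k i j : i \in Z -> ((d - 1) ^ 2 < t)%N -> k = t %[mod l] ->
  (C_mx G 0 Z * S_mx G 0 Z ^+ k * R_mx G 0 Z) j i = (G ^+ t) j i.
Proof.
move=> iZ t_gt kt; have scaleG : fin (- 0) *: G = G by rewrite oppr0 scale1r.
pose U := mxplus (G ^+ l); have UE : U_mx G 0 Z = U by rewrite /U_mx scaleG.
have d_gt0 : (0 < d)%N by case: (d) (i) => // -[].
have l_gt0 : (0 < l)%N by case: (Z) iZ.
apply: dle_anti.
  apply: (dle_trans (b := (U * G ^+ k * U) j i)).
    move: j i {iZ}; apply/dle_mxP; apply: dleM; first apply: dleM.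
    - apply/dle_mxP => x y; rewrite mxE UE.
      by case: ifP => _; [apply: Rmax_addrr | apply: dle0].
    - apply: dleX; first exact: mx_addrr.
      apply/dle_mxP => x y; rewrite mxE oppr0 mul1r.
      by case: ifP => _; [apply: Rmax_addrr | apply: dle0].
    - apply/dle_mxP => x y; rewrite mxE UE.
      by case: ifP => _; [apply: Rmax_addrr | apply: dle0].
  rewrite /U /mxplus !mulr_suml summxE; apply: dle_sum => a _ _.
  rewrite mulr_sumr summxE; apply: dle_sum => b _ _.
  rewrite -!exprM -!exprD; apply: (pow_reduction G_le1 Z_uniq Z_tight) => //.
  by rewrite addnC !(mulnC l) modnMDl modnMDl.
pose x := iter (l.-1 * k) nx i; have xZ : x \in Z by rewrite mem_iter_next.
have def_i : iter k nx x = i.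
  rewrite -iterD -{1}[k]mul1n -mulnDl add1n prednK //.
  by rewrite -[RHS]/(iter 0 nx i); apply: iter_next_mod; rewrite // modnMr mod0n.
apply: (dle_trans (b := U j x * (S_mx G 0 Z ^+ k) x i * U i i)); last first.
  apply: (dle_trans (b := (C_mx G 0 Z * S_mx G 0 Z ^+ k) j i * R_mx G 0 Z i i));
    last exact: mulmx_entry_dle.
  apply: dleM; last by rewrite mxE iZ UE; apply: Rmax_addrr.
  apply: dle_trans (mulmx_entry_dle _ _ _ x _).
  by apply: dleM; [rewrite mxE xZ UE|]; apply: Rmax_addrr.
rewrite S_mx_pow // def_i eqxx mulr1 -[X in X <=+ _]mulr1.
have Gl_np : cycles_nonpos (G ^+ l).
  by apply: cycles_nonpos_le1 => u v; apply: pow_le1.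
have U_ge a u v : (0 < a)%N -> (G ^+ (l * a)) u v <=+ U u v.
  by move=> a0; rewrite exprM; move: u v; apply/dle_mxP; apply: pow_dle_plus.
apply: dleM; last first.
  apply: dle_trans (U_ge 1%N i i _); rewrite // muln1.
  by have := tight_pow Z_tight l iZ; rewrite iter_next_size.
(* A walk of length [t] to [i], followed by the [l.-1 * k] steps along [Z] to [x], has length
   divisible by [l] and so is counted in [U j x]. *)
have /dvdnP[a def_a] : (l %| t + l.-1 * k)%N.
  rewrite /dvdn -modnDml -kt modnDml -{1}[k]mul1n -mulnDl add1n prednK //.
  by rewrite modnMr.
have a_gt0 : (0 < a)%N.
  rewrite lt0n; apply: contraTneq t_gt => a0; move/eqP: def_a.
  by rewrite a0 mul0n addn_eq0 => /andP[/eqP-> _].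
apply: dle_trans (U_ge a j x a_gt0); rewrite mulnC -def_a.
apply: (pow_extend Z_uniq Z_tight _ iZ); first exact: leq_addr.
by rewrite /x -iterD.
Qed.

End CSR.

(** * Cycle means, normalization and potentials *)

Section CycleMeans.
Variables (R : realFieldType) (d : nat).
Implicit Types (X : 'M[Rmax R]_d) (c : seq 'I_d).

Lemma prod_neq0 (I : eqType) (r : seq I) (f : I -> Rmax R) i :
  \prod_(j <- r) f j != 0 -> i \in r -> f i != 0.
Proof.
by move=> p_n0 ir; move: p_n0; rewrite (big_rem i ir) Rmax_mulf_neq0 => /andP[].
Qed.

Lemma cycle_mean_dle_mcm X c : uniq c -> c != [::] -> cycle_mean X c <=+ mcm X.
Proof.
move=> Uc c_n0; have [c0|c_n0'] := eqVneq (cycle_weight X c) 0.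
  by rewrite /cycle_mean -/(cycle_weight X c) c0; apply: dle0.
apply: (dle_bigsum (@Rmax_addrr R)); rewrite mem_cycles c_n0 /ucycleb Uc andbT.
by apply: cycle_from_next => // i ic; apply: prod_neq0 c_n0' ic.
Qed.

Lemma size_neq0 c : c != [::] -> 0 < (size c)%:R :> R.
Proof. by rewrite ltr0n lt0n size_eq0. Qed.

Lemma cycles_nonpos_mcm X : rmax_nonpos (mcm X) -> cycles_nonpos X.
Proof.
move=> Xnp c Uc c_n0; have := cycle_mean_dle_mcm X Uc c_n0.
rewrite /cycle_mean -/(cycle_weight X c).
case: (cycle_weight X c) => [w|_]; last exact: dle0.
case: (mcm X) Xnp => [x|] //= x_le0 /dle_fin w_le; apply/dle_fin.
have := le_trans w_le x_le0; rewrite pmulr_lle0 // invr_gt0; exact: size_neq0.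
Qed.

Definition normalize (lam : R) X : 'M[Rmax R]_d := fin (- lam) *: X.

Lemma prod_fin (I : Type) (r : seq I) (f : I -> R) :
  \prod_(i <- r) fin (f i) = fin (\sum_(i <- r) f i).
Proof.
by elim: r => [|i r IHr]; rewrite ?big_nil // !big_cons IHr.
Qed.

Lemma cycle_weight_normalize lam X c :
  cycle_weight (normalize lam X) c = fin (- lam *+ size c) * cycle_weight X c.
Proof.
rewrite /cycle_weight -finX; under eq_bigr do rewrite mxE.
by rewrite big_split big_const_seq count_predT iter_mulr mulr1.
Qed.

Lemma cycles_nonpos_normalize lam X : mcm X = fin lam ->
  cycles_nonpos (normalize lam X).
Proof.
move=> def_lam c Uc c_n0; have := cycle_mean_dle_mcm X Uc c_n0.
rewrite cycle_weight_normalize def_lam /cycle_mean -/(cycle_weight X c).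
case: (cycle_weight X c) => [w|_]; last exact: dle0.
move=> /dle_fin; rewrite ler_pdivrMr ?size_neq0 // finM => w_le; apply/dle_fin.
by rewrite mulNrn -mulr_natr addrC subr_le0.
Qed.

Lemma irreducible_elementary X i j : irreducible X ->
  exists2 s, (s < d)%N & (X ^+ s) i j != 0.
Proof.
move=> /(_ i j)/connectP[s0]; case/shortenP=> s Xs Us _ ->; exists (size s).
  rewrite -[X in (_ < X)%N](card_ord d) -[(size s).+1]/(size (i :: s)).
  by rewrite -(card_uniqP Us) max_card.
apply: dle_neq0 (walk_weight_dle_pow X i s) _.
elim: s i Xs {Us} => //= x s IHs i /andP[Xix /IHs]; rewrite Rmax_mulf_neq0.
by rewrite andbC => ->.
Qed.

Lemma normalize_pow lam X n i j :
  (normalize lam X ^+ n) i j = fin (- lam *+ n) * (X ^+ n) i j.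
Proof.
have -> : normalize lam X ^+ n = (fin (- lam) ^+ n) *: X ^+ n.
  elim: n => [|n IHn]; first by rewrite scale1r.
  by rewrite !exprS IHn -!mulmxE -scalemxAl -scalemxAr scalerA.
by rewrite mxE finX.
Qed.

Lemma finMA (a b : R) x : fin a * (fin b * x) = fin (a + b) * x.
Proof. by rewrite mulrA finM. Qed.

Lemma Rmax_mul1_eq1 (a b : Rmax R) : a <=+ 1 -> b <=+ 1 -> a * b = 1 -> a = 1.
Proof.
move=> a1 b1 ab; apply: dle_anti => //; rewrite -ab -[X in _ <=+ X]mulr1.
by apply: dleM; first exact: Rmax_addrr.
Qed.

(** The normalized matrix conjugated by the diagonal matrix of [p]. *)
Definition tilt (p : 'I_d -> R) (lam : R) X : 'M[Rmax R]_d :=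
  \matrix_(i, j) (fin (p j - p i - lam) * X i j).

Lemma cycle_weight_tilt p lam X c : uniq c ->
  cycle_weight (tilt p lam X) c = cycle_weight (normalize lam X) c.
Proof.
move=> Uc; rewrite /cycle_weight.
under eq_bigr do rewrite mxE -finMA.
under [in RHS]eq_bigr do rewrite mxE.
rewrite big_split /= prod_fin sumrB -(big_map (next c) predT p).
suff pc : perm_eq (map (next c) c) c by rewrite (perm_big _ pc) subrr mul1r.
by case: c Uc => // x c Uc; rewrite map_next // perm_rcons.
Qed.

(** A column of the Kleene star of the normalized matrix [N] serves as potential: it is finite by
    irreducibility, and [N * mxstar N] is below [mxstar N]. *)
Lemma potential X lam : irreducible X -> mcm X = fin lam ->
  exists p, (forall i j, tilt p lam X i j <=+ 1) /\
            (forall i j, crit_arc X i j -> tilt p lam X i j = 1).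
Proof.
move=> X_irr def_lam; set N := normalize lam X.
have N_np : cycles_nonpos N by apply: cycles_nonpos_normalize.
case: (posnP d) => [d0|d_gt0].
  by exists (fun=> 0); split=> -[i i_lt]; exfalso; move: i_lt; rewrite d0.
pose k : 'I_d := Ordinal d_gt0.
have star_n0 i : mxstar N i k != 0.
  have [s _ Xs] := irreducible_elementary i k X_irr.
  move: (pow_dle_star s N_np) => /dle_mxP/(_ i k)/dle_neq0; apply.
  by rewrite normalize_pow Rmax_mulf_neq0.
pose p i := if mxstar N i k is Some x then x else 0.
have def_p i : mxstar N i k = fin (p i).
  by rewrite /p; case: (mxstar N i k) (star_n0 i).
have p_le i j : tilt p lam X i j <=+ 1.
  have : N i j * mxstar N j k <=+ mxstar N i k.
    apply: dle_trans (mulmx_entry_dle _ _ _ _ _) _.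
    move: i k {star_n0 p def_p}; apply/dle_mxP.
    rewrite {1}/mxstar mulr_sumr; apply: dle_sum => a _ _.
    by rewrite -exprS; apply: pow_dle_star.
  rewrite !def_p !mxE; case: (X i j) => [x|] //=.
  by rewrite !finM => /dle_fin ?; apply/dle_fin; lra.
exists p; split=> // i j /hasP[c]; rewrite mem_filter => /andP[c_opt].
rewrite mem_cycles => /andP[c_n0 /andP[_ Uc]] /andP[ic /eqP def_j].
(* The potential cancels around an optimal cycle, whose total weight is thus the real number 0. As
   no factor exceeds it, each arc has weight 0. *)
have : cycle_weight (tilt p lam X) c = 1.
  rewrite cycle_weight_tilt // cycle_weight_normalize.
  move: c_opt; rewrite def_lam /cycle_mean -/(cycle_weight X c).
  case: (cycle_weight X c) => [w|] //= /eqP[def_w].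
  rewrite finM; congr fin; rewrite mulNrn -mulr_natr -def_w divfK ?addNr //.
  by rewrite gt_eqF ?size_neq0.
rewrite /cycle_weight (big_rem i ic) /= def_j; apply: Rmax_mul1_eq1 => //.
exact: prod_dle1.
Qed.

End CycleMeans.

(** * Conjugation by a diagonal matrix *)

Section Gauge.
Variables (R : realFieldType) (d : nat) (p : 'I_d -> R).
Implicit Types (X Y V : 'M[Rmax R]_d).

(** With D the diagonal matrix of [p], this is X = D Y D^-1, and [act V] below is V D. *)
Definition gauge X Y : Prop := forall i j, X i j = fin (p i - p j) * Y i j.

Lemma finMACA (a b : R) x y : (fin a * x) * (fin b * y) = fin (a + b) * (x * y).
Proof. by rewrite mulrACA finM. Qed.

Lemma gaugeM X Y X' Y' : gauge X Y -> gauge X' Y' -> gauge (X * X') (Y * Y').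
Proof.
move=> XY XY' i j; rewrite !mxE big_distrr /=; apply: eq_bigr => k _.
by rewrite XY XY' finMACA addrA subrK.
Qed.

Lemma gauge1 : gauge 1 1.
Proof.
move=> i j; rewrite !mxE; case: eqP => [->|_] /=; first by rewrite subrr mul1r.
by rewrite mulr0.
Qed.

Lemma gaugeX X Y n : gauge X Y -> gauge (X ^+ n) (Y ^+ n).
Proof.
move=> XY; elim: n => [|n IHn]; first exact: gauge1.
by rewrite !exprS; apply: gaugeM.
Qed.

Lemma gauge_plus X Y : gauge X Y -> gauge (mxplus X) (mxplus Y).
Proof.
move=> XY i j; rewrite !summxE big_distrr /=; apply: eq_bigr => k _.
exact: gaugeX.
Qed.

Definition act V : 'M[Rmax R]_d := \matrix_(q, j) (V q j * fin (p j)).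

Lemma gauge_act V X Y q i : gauge X Y ->
  (V * X) q i = fin (- p i) * (act V * Y) q i.
Proof.
move=> XY; rewrite !mxE big_distrr /=; apply: eq_bigr => k _.
rewrite XY mxE; case: (V q k) (Y k i) => [x|] [y|] //.
by rewrite !finM; congr fin; lra.
Qed.

End Gauge.

(** * Completeness and soundness of Part 2 of the discrete logarithm *)

Section DiscreteLogarithm.
Variables (R : realFieldType) (d : nat) (F V : 'M[Rmax R]_d) (lam : R).
Variable (Z : seq 'I_d).
Hypothesis F_irr : irreducible F.
Hypothesis F_ge1 : 1 <=+ F.
Hypothesis def_lam : mcm F = fin lam.
Hypothesis lam_gt0 : 0 < lam.
Hypothesis Z_crit : critical_cycle F Z.
Hypothesis V_neq0 : V <> 0.

Local Notation l := (size Z).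
Local Notation nx := (next Z).

Lemma critical_uniq : uniq Z.
Proof. by move: Z_crit; rewrite /critical_cycle mem_cycles => /and3P[]. Qed.

Lemma critical_size_gt0 : (0 < l)%N.
Proof.
by move: Z_crit; rewrite /critical_cycle mem_cycles lt0n size_eq0 => /andP[].
Qed.

(** Everything that Part 2 compares is rewritten through the tilted matrix [G], for which the arcs
    of [Z] are tight. The exponent then appears in the scalar [lam *+ n] and as a rotation of the
    columns along [Z]. *)
Lemma normal_form : exists W : 'M[Rmax R]_d, exists p : 'I_d -> R,
  exists G : 'M[Rmax R]_d,
  [/\ forall n q i, (V * F ^+ n) q i = fin (lam *+ n - p i) * (W * G ^+ n) q i,
      forall n k q i, i \in Z -> ((d - 1) ^ 2 < n)%N -> k = n %[mod l] ->
        (V * (C_mx F lam Z * S_mx F lam Z ^+ k * R_mx F lam Z)) q i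
          = fin (- p i) * (W * G ^+ n) q i &
      forall t t' i i' q, i \in Z -> i' \in Z ->
        ((d - 1) ^ 2 < t)%N -> ((d - 1) ^ 2 < t')%N ->
        iter t' nx i = iter t nx i' -> (W * G ^+ t) q i = (W * G ^+ t') q i'].
Proof.
have [p [G_le1 G_tight]] := potential F_irr def_lam.
set G := tilt p lam F in G_le1 G_tight.
have Z_tight i : i \in Z -> G i (nx i) = 1.
  move: Z_crit; rewrite /critical_cycle mem_cycles => /andP[_ /andP[Zc _]] iZ.
  by apply/G_tight/next_cycle.
have FG : gauge p (normalize lam F) G.
  by move=> i j; rewrite !mxE finMA; congr (fin _ * _); lra.
have scaleG : fin (- 0) *: G = G by rewrite oppr0 scale1r.
have UU : gauge p (U_mx F lam Z) (U_mx G 0 Z).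
  by rewrite /U_mx scaleG; apply/gauge_plus/gaugeX.
have CC : gauge p (C_mx F lam Z) (C_mx G 0 Z).
  by move=> i j; rewrite !mxE; case: ifP; rewrite ?mulr0 // UU.
have RR : gauge p (R_mx F lam Z) (R_mx G 0 Z).
  by move=> i j; rewrite !mxE; case: ifP; rewrite ?mulr0 // UU.
have SS : gauge p (S_mx F lam Z) (S_mx G 0 Z).
  move=> i j; rewrite !mxE; case: ifP => _; rewrite ?mulr0 //.
  by have := FG i j; rewrite !mxE oppr0 mul1r => ->.
exists (act p V), p, G; split.
- move=> n q i; have := gauge_act V q i (gaugeX n FG).
  have -> : V * normalize lam F ^+ n = fin (- lam *+ n) *: (V * F ^+ n).
    apply/matrixP=> x y; rewrite !mxE big_distrr /=; apply: eq_bigr => k _.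
    by rewrite normalize_pow mulrCA.
  rewrite mxE => /(congr1 (fun x => fin (lam *+ n) * x)); rewrite !finMA.
  by rewrite mulNrn subrr mul1r.
- move=> n k q i iZ n_gt kn.
  rewrite (gauge_act V q i (gaugeM (gaugeM CC (gaugeX k SS)) RR)).
  congr (_ * _); rewrite !mxE; apply: eq_bigr => j _; congr (_ * _).
  exact: (CSR_tight G_le1 critical_uniq Z_tight j iZ n_gt kn).
- move=> t t' i i' q iZ i'Z t_gt t'_gt eqi; rewrite !mxE.
  apply: eq_bigr => j _; congr (_ * _).
  exact: (tight_pow_eq G_le1 critical_uniq Z_tight j iZ i'Z t_gt t'_gt eqi).
Qed.

Lemma col_entry (X Y C : 'M[Rmax R]_d) a i :
  col i X = a *: (Y *m col i C) <-> forall q, X q i = a * (Y * C) q i.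
Proof.
have E q : (a *: (Y *m col i C)) q 0 = a * (Y * C) q i.
  by rewrite !mxE; congr (_ * _); apply: eq_bigr => k _; rewrite mxE.
split=> [XYC q|XYC].
  by rewrite -E -XYC mxE.
by apply/matrixP=> q j; rewrite ord1 E -XYC mxE.
Qed.

Lemma part2_complete t : ((d - 1) ^ 2 < t)%N ->
  part2_check F lam Z (V *m F ^+ t) V (t %% l) t.
Proof.
move=> t_gt; have [W [p [G [VF VC _]]]] := normal_form.
exists (lam *+ t); split=> [i iZ|]; last first.
  by rewrite -[lam *+ t]mulr_natl mulfK // gt_eqF.
apply/col_entry => q; rewrite !mulmxE VF (VC t) ?modn_mod //.
by rewrite finMA.
Qed.

(** A finite entry of [V] is continued by a walk of fewer than [d] arcs to [i]; since [1 <=+ F],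
    finite entries persist in higher powers. *)
Lemma VF_pow_neq0 t i : (d - 1 <= t)%N -> exists q, (V * F ^+ t) q i != 0.
Proof.
move=> t_ge; have [q [k Vqk]] : exists q k, V q k != 0.
  apply: contra_notP V_neq0 => V0; apply/matrixP=> q k; rewrite mxE.
  by apply/eqP; apply: contra_notT V0 => Vqk; exists q, k.
have [s s_lt Fs] := irreducible_elementary k i F_irr.
exists q; apply: dle_neq0 (mulmx_entry_dle _ _ _ k _) _.
rewrite Rmax_mulf_neq0 Vqk; apply: dle_neq0 Fs.
move: k i {Vqk}; apply/dle_mxP; apply: dle_exp => //; first exact: mx_addrr.
by move: s_lt t_ge; lia.
Qed.

Lemma part2_sound t0 k t : ((d - 1) ^ 2 < t0)%N ->
  part2_check F lam Z (V *m F ^+ t0) V k t -> t = t0.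
Proof.
move=> t0_gt [mu [cols mu_t]]; have [W [p [G [VF VC shift]]]] := normal_form.
have l_gt0 := critical_size_gt0.
(* [s] is a natural number congruent to [k - t0] modulo [l], the rotation that the check asserts,
   and [e] is the accompanying scalar, which has to be shown to be 0. *)
pose s := (k + l * t0 - t0)%N; pose e := (lam * (t%:R - t0%:R)).
have s_t0 : (t0 + s = k + l * t0)%N.
  by rewrite subnKC // (leq_trans _ (leq_addl _ _)) // leq_pmull.
have big n : ((d - 1) ^ 2 < t0 + n)%N by rewrite (leq_trans t0_gt) ?leq_addr.
have def_mu : mu = lam * t%:R by rewrite -mu_t mulrC divfK // gt_eqF.
have step i q : i \in Z -> (W * G ^+ t0) q i = fin e * (W * G ^+ (t0 + s)) q i.
  move=> iZ; have /col_entry/(_ q) := cols i iZ.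
  rewrite !mulmxE VF (VC (t0 + s)%N) //; last first.
    by rewrite s_t0 addnC mulnC modnMDl.
  move/(congr1 (fun x => fin (p i - lam *+ t0) * x)); rewrite !finMA def_mu.
  have -> : p i - lam *+ t0 + (lam *+ t0 - p i) = 0.
    by rewrite addrA subrK subrr.
  rewrite mul1r => ->; congr (fin _ * _).
  by rewrite /e mulrBr -[lam *+ t0]mulr_natr; lra.
have steps m i q : i \in Z ->
    (W * G ^+ t0) q i = fin (e *+ m) * (W * G ^+ (t0 + m * s)) q i.
  elim: m i => [|m IHm] i iZ; first by rewrite mul1r addn0.
  (* The node [m * s] steps before [i]: there the power [t0] has the column that the power
     [t0 + m * s] has at [i], so [step] applies once more. *)
  pose i' := iter (l.-1 * (m * s)) nx i.
  have i'Z : i' \in Z by rewrite mem_iter_next.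
  have back n : iter (n + m * s) nx i' = iter n nx i.
    rewrite -iterD -addnA -{1}[(m * s)%N]mul1n -mulnDl add1n prednK //.
    by apply: (iter_next_mod critical_uniq iZ); rewrite addnC mulnC modnMDl.
  rewrite IHm // -(shift t0 (t0 + m * s)%N i' i) ?back // step //.
  rewrite finMA -mulrSr mulSn addnCA addnA [(_ + t0)%N]addnC.
  by rewrite (shift (t0 + s)%N (t0 + s + m * s)%N i' i) ?back // -addnA.
have [i iZ] : exists i, i \in Z.
  by case: (Z) l_gt0 => // i c; exists i; rewrite mem_head.
have [q] : exists q, (V * F ^+ t0) q i != 0.
  apply: VF_pow_neq0; apply: leq_trans (ltnW t0_gt).
  by case: (d - 1)%N => // c; rewrite expnS leq_pmulr ?expn_gt0.
rewrite VF Rmax_mulf_neq0 => /andP[_]; have := steps l i q iZ.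
(* After [l] steps the rotation is trivial, and a finite entry equals itself plus [e *+ l]. Hence
   [e] vanishes, and [t = t0] because [lam] is positive. *)
rewrite (shift (t0 + l * s)%N t0 i i) //; last first.
  by apply: (iter_next_mod critical_uniq iZ); rewrite addnC mulnC modnMDl.
case: ((W * _) q i) => // x; rewrite -[Some x]/(fin x) finM => -[] /esym/eqP.
rewrite -subr_eq0 addrK -mulr_natr !mulf_eq0 pnatr_eq0 (gtn_eqF l_gt0) orbF.
by rewrite (gt_eqF lam_gt0) subr_eq0 eqr_nat => /eqP.
Qed.

End DiscreteLogarithm.

(** * Runs of the attack *)

Section KleeneStar.
Variables (R : realFieldType) (d : nat) (M H : 'M[Rmax R]_d).
Hypothesis d_gt0 : (0 < d)%N.
Hypothesis H_nonpos : rmax_nonpos (mcm H).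

Lemma expr1D_star n : (d.-1 <= n)%N -> (1 + H) ^+ n = mxstar H.
Proof.
move=> n_ge; apply: dle_anti.
  rewrite (expr1D (@mx_addrr R d d)); apply: dle_sum => k _ _.
  exact/pow_dle_star/cycles_nonpos_mcm.
have -> : mxstar H = (1 + H) ^+ d.-1.
  by rewrite (expr1D (@mx_addrr R d d)) prednK.
by apply: dle_exp => //; [exact: mx_addrr | apply/dleDr/mx_addrr].
Qed.

Lemma message_star k : (d.-1 <= k)%N -> message M H k.+2 = (M + H) * mxstar H.
Proof.
move=> k_ge; rewrite messageE /attack_V mulmxE mulrDl -mulrA -exprS.
by rewrite !expr1D_star ?leqW // mulrDl.
Qed.

Lemma message_star_absorbing m n : (0 < m)%N -> (0 < n)%N ->
    message M H m = (M + H) * mxstar H ->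
  message M H (m + n) = (M + H) * mxstar H.
Proof.
move=> m0 n0 Hm; rewrite message_add // Hm -{1}(expr1D_star (leqnn _)) -mulrA -exprD.
(* The star is written as a power with exponent at least [n - 1], so that it visibly absorbs
   [H * (1 + H) ^+ (n - 1)]. *)
rewrite expr1D_star ?leq_addr // [LHS]addrC -(expr1D_star (leq_maxl _ (n - 1))).
apply: dleM; first exact/dleDl/mx_addrr.
by apply: dle_exp; [exact: mx_addrr | apply/dleDr/mx_addrr | rewrite leq_maxr].
Qed.

End KleeneStar.

(** * Existence of critical cycles and positivity of the cycle mean *)

Section CriticalCycles.
Variables (R : realFieldType) (d : nat).
Implicit Types (X H : 'M[Rmax R]_d).

Lemma critical_cycle_exists X lam : mcm X = fin lam -> exists Z, critical_cycle X Z.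
Proof.
move=> def_lam; have : mcm X != 0 by rewrite def_lam.
case/Rmax_sum_attained=> c cX c_opt; exists c.
have := cX; rewrite /critical_cycle !mem_cycles => /andP[-> /andP[_ Uc]].
rewrite /ucycleb Uc andbT; apply: cycle_from_next => // i ic.
by apply/hasP; exists c; [rewrite mem_filter cX andbT; apply/eqP | rewrite ic /=].
Qed.

(** Adding the identity only increases weights, so an optimal cycle of [H] keeps a positive mean. *)
Lemma mcm_1D_gt0 H : ~~ rmax_nonpos (mcm H) ->
  exists2 lam, mcm (1 + H) = fin lam & 0 < lam.
Proof.
case def_x: (mcm H) => [x|] //=; rewrite -ltNge => x_gt0.
have : mcm H != 0 by rewrite def_x.
case/Rmax_sum_attained=> c; rewrite mem_cycles => /andP[c_n0 /andP[_ Uc]].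
rewrite -/(mcm H) def_x /cycle_mean -/(cycle_weight H c) => c_mean.
have : cycle_weight H c <=+ cycle_weight (1 + H) c.
  apply: (big_rec2 (fun a b => a <=+ b)) => [|i a b _ ab]; first exact: Rmax_addrr.
  by apply: dleM => //; move: i (next c i); apply/dle_mxP/dleDl/mx_addrr.
have := cycle_mean_dle_mcm (1 + H) Uc c_n0.
rewrite /cycle_mean -/(cycle_weight (1 + H) c).
case: (cycle_weight H c) c_mean => [w|] //= [def_w].
case: (cycle_weight (1 + H) c) => [w'|] //=; case: (mcm _) => [lam|] //.
move=> /dle_fin w'_le /dle_fin w_le; exists lam => //.
apply: lt_le_trans w'_le; apply: lt_le_trans x_gt0 _; rewrite -def_w.
by rewrite ler_pM2r // invr_gt0 size_neq0.
Qed.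

End CriticalCycles.

(** * Correctness of the searches and of the attack *)

Section AttackRuns.
Variables (R : realFieldType) (d : nat) (M H : 'M[Rmax R]_d).
Local Notation F := (1 + H).
Local Notation V := (attack_V M H).

Definition correct_search (A : 'M[Rmax R]_d) (search : option nat -> Prop) :=
  [/\ exists l, search (Some l), ~ search None &
      forall l, search (Some l) -> A = V * F ^+ l].

Lemma exponent_exists A search : (A <> M -> correct_search A search) ->
  exists r, exponent M A search r.
Proof.
have [->|/eqP AM] := eqVneq A M; first by exists (Some 1%N); apply: ExponentOne.
by case/(_ AM)=> -[l Sl] _ _; exists (Some l.+2); apply: ExponentFound.
Qed.

Lemma exponent_correct A search r : (A <> M -> correct_search A search) ->
  exponent M A search r ->
  exists k, [/\ r = Some k, (0 < k)%N & message M H k = A].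
Proof.
move=> S_ok [->|l AM Sl|AM SN].
- by exists 1%N.
- by have [_ _ /(_ l Sl) ->] := S_ok AM; exists l.+2; rewrite messageE.
- by have [_ /(_ SN)] := S_ok AM.
Qed.

(** From exponent [d.-1] of [1 + H] on, the message has the star value, so any other message but [M]
    is within the search range. *)
Lemma small_dlog_correct m : (0 < d)%N -> rmax_nonpos (mcm H) -> (0 < m)%N ->
    message M H m <> (M + H) *m mxstar H -> message M H m <> M ->
  correct_search (message M H m) (small_dlog (message M H m) V F).
Proof.
case: m => [|[|k]] // d_gt0 H_np _ notK notM.
have k_lt : (k < d.-1)%N.
  by rewrite ltnNge; apply/negP=> /(message_star M d_gt0 H_np).
split; [exists k; split=> //; exact: messageE| |by move=> l []].
by move=> /(_ k k_lt); rewrite messageE.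
Qed.

Lemma dlog_correct m : irreducible F -> V <> 0 -> ~~ rmax_nonpos (mcm H) ->
    (0 < m)%N -> message M H m <> M ->
  correct_search (message M H m) (dlog (message M H m) V F).
Proof.
case: m => [|[|t]] // F_irr V_n0 H_pos _ _; rewrite messageE.
have [lam def_lam lam_gt0] := mcm_1D_gt0 H_pos.
have F_ge1 : 1 <=+ F by apply/dleDr/mx_addrr.
(* Part 2 is entered only when Part 1 fails, hence only with a true exponent above the threshold
   where the column identities hold. *)
have late : (forall s, (s <= (d - 1) ^ 2)%N -> V * F ^+ t <> V * F ^+ s) ->
    ((d - 1) ^ 2 < t)%N.
  by move=> no_s; rewrite ltnNge; apply/negP=> /no_s.
have dlog_found r : dlog (V * F ^+ t) V F r ->
    exists2 l, r = Some l & V * F ^+ t = V * F ^+ l.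
  case=> lam' [Z [+ Z_crit]]; rewrite def_lam => -[<-].
  case=> [l _ def_A _|k l no_s _ check_k _|no_s no_k].
  - by exists l.
  - exists l => //; have t_gt := late no_s.
    by rewrite (part2_sound F_irr F_ge1 def_lam lam_gt0 Z_crit V_n0 t_gt check_k).
  - case: (no_k (t %% size Z)%N t); first exact/ltn_pmod/critical_size_gt0/Z_crit.
    exact: (part2_complete V F_irr def_lam lam_gt0 Z_crit (late no_s)).
split.
- have [Z Z_crit] := critical_cycle_exists def_lam.
  suff [l l_dlog] : exists l, dlog_search F lam Z (V * F ^+ t) V (Some l).
    by exists l, lam, Z.
  pose found s := (s <= (d - 1) ^ 2)%N && (V * F ^+ t == V * F ^+ s).
  have [ex_s|no_s] := pselect (exists s, found s).
    case: (ex_minnP ex_s) => s /andP[s_le /eqP def_A] s_min.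
    exists s; apply: DlogPart1 => // r rs def_A'.
    have := s_min r; rewrite /found def_A' eqxx andbT (leq_trans (ltnW rs)) //.
    by rewrite leqNgt rs => /(_ isT).
  have {}no_s s : (s <= (d - 1) ^ 2)%N -> V * F ^+ t <> V * F ^+ s.
    by move=> s_le /eqP def_A; apply: no_s; exists s; rewrite /found s_le.
  pose check k := `[< exists u, part2_check F lam Z (V * F ^+ t) V k u >].
  have ex_k : exists k, check k.
    exists (t %% size Z)%N; apply/asboolP; exists t.
    exact: (part2_complete V F_irr def_lam lam_gt0 Z_crit (late no_s)).
  case: (ex_minnP ex_k) => k /asboolP[u check_k] k_min.
  exists u; apply: DlogPart2 check_k _ => //.
    (* The first successful [k] is at most [t %% size Z], which succeeds by completeness, and so
       lies in the range of the search. *)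
    apply: leq_ltn_trans (ltn_pmod t (critical_size_gt0 Z_crit)).
    apply: k_min; apply/asboolP; exists t.
    exact: (part2_complete V F_irr def_lam lam_gt0 Z_crit (late no_s)).
  move=> k' t' k'k check_k'; have := k_min k'; rewrite leqNgt k'k => /implyP.
  by apply/negP; rewrite implybF negbK; apply/asboolP; exists t'.
- by case/dlog_found.
- by move=> l /dlog_found[_ [<-]].
Qed.

End AttackRuns.

Theorem proposition4p6 (R : realType) (d : nat) (M H : 'M[Rmax R]_d)
    (M_int : forall i j, rmax_integral (M i j))
    (H_int : forall i j, rmax_integral (H i j))
    (F_irr : irreducible (1 + H))
    (F_crit : crit_strongly_connected (1 + H))
    (V_neq0 : M *m (1 + H) + H <> 0)
    (m n : nat) (m_ge1 : (1 <= m)%N) (n_ge1 : (1 <= n)%N)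
    (A B : 'M[Rmax R]_d) (A_def : A = message M H m) (B_def : B = message M H n) :
  alice_key H m A B = bob_key H n A B /\
  (forall r, attack M H A B r <-> r = Some (alice_key H m A B)).
Proof.
(* For [d = 0] every matrix is zero, against the assumption on [V]. *)
have d_gt0 : (0 < d)%N.
  case: (posnP d) V_neq0 => // d0 []; apply/matrixP=> -[i i_lt].
  by exfalso; move: i_lt; rewrite d0.
have key : alice_key H m A B = message M H (m + n).
  by rewrite A_def B_def alice_keyE.
split.
  by rewrite key -alice_bob_key A_def B_def alice_keyE // addnC.
have step3_key k k' : (0 < k)%N -> (0 < k')%N ->
    message M H k = A -> message M H k' = B ->
    step3_result H A B (Some k) (Some k') = Some (alice_key H m A B).
  move=> k0 k'0 def_A def_B; rewrite key /step3_result -def_A -def_B.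
  by rewrite step3_message // (@message_add_eq _ _ M H m n) // ?def_A ?def_B.
have star_key : rmax_nonpos (mcm H) ->
    A = (M + H) *m mxstar H \/ B = (M + H) *m mxstar H ->
    alice_key H m A B = (M + H) *m mxstar H.
  rewrite key A_def B_def => H_np [|]; last rewrite addnC.
    exact: message_star_absorbing.
  exact: message_star_absorbing.
have star_search (H_np : rmax_nonpos (mcm H)) : A <> (M + H) *m mxstar H -> A <> M ->
    correct_search M H A (small_dlog A (attack_V M H) (attack_F H)).
  by rewrite A_def; apply: small_dlog_correct.
have star_search' (H_np : rmax_nonpos (mcm H)) :
    B <> (M + H) *m mxstar H -> B <> M ->
    correct_search M H B (small_dlog B (attack_V M H) (attack_F H)).
  by rewrite B_def; apply: small_dlog_correct.
have log_search (H_pos : ~~ rmax_nonpos (mcm H)) : A <> M ->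
    correct_search M H A (dlog A (attack_V M H) (attack_F H)).
  by rewrite A_def; apply: dlog_correct.
have log_search' (H_pos : ~~ rmax_nonpos (mcm H)) : B <> M ->
    correct_search M H B (dlog B (attack_V M H) (attack_F H)).
  by rewrite B_def; apply: dlog_correct.
have sound r : attack M H A B r -> r = Some (alice_key H m A B).
  case=> [H_np AB|ra rb H_np nA nB ea eb|ra rb H_pos ea eb].
  - by rewrite star_key.
  - have [k [-> k0 def_A]] := exponent_correct (star_search H_np nA) ea.
    have [k' [-> k'0 def_B]] := exponent_correct (star_search' H_np nB) eb.
    exact: step3_key.
  - have [k [-> k0 def_A]] := exponent_correct (log_search H_pos) ea.
    have [k' [-> k'0 def_B]] := exponent_correct (log_search' H_pos) eb.
    exact: step3_key.
(* All runs return the key, so for the converse it suffices that some run ends. *)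
suff [r0 r0_run] : exists r0, attack M H A B r0.
  by move=> r; split=> [|->]; [apply: sound | rewrite -(sound _ r0_run)].
have [H_np|H_pos] := boolP (rmax_nonpos (mcm H)); last first.
  have [ra ea] := exponent_exists (log_search H_pos).
  have [rb eb] := exponent_exists (log_search' H_pos).
  by exists (step3_result H A B ra rb); apply: AttackStep2.
have [starA|/eqP nA] := eqVneq A ((M + H) *m mxstar H).
  by exists (Some ((M + H) *m mxstar H)); apply: AttackStar H_np _; left.
have [starB|/eqP nB] := eqVneq B ((M + H) *m mxstar H).
  by exists (Some ((M + H) *m mxstar H)); apply: AttackStar H_np _; right.
have [ra ea] := exponent_exists (star_search H_np nA).
have [rb eb] := exponent_exists (star_search' H_np nB).
by exists (step3_result H A B ra rb); apply: AttackStep1.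
Qed.
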